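(* Let $d\ge2$ be an integer, let $f:\mathbb{R}\to\mathbb{R}$ be continuous, nonnegative and $1$-periodic, and suppose that the transfer operator $L:C(\mathbb{T})\to C(\mathbb{T})$, $(Lu)(t)=\frac1d\sum_{i=0}^{d-1} f\left(\frac{t+i}{d}\right)u\left(\frac{t+i}{d}\right)$, is a Krein operator. Let $r=\lim_{n\to\infty}\left(\min_{t\in\mathbb{T}}(L^n1)(t)\right)^{1/n}$ and $R=\lim_{n\to\infty}\left(\max_{t\in\mathbb{T}}(L^n1)(t)\right)^{1/n}$. Then the following hold. (a) $R>0$. (b) If $v\in C(\mathbb{T})$, $v\neq0$, $\lambda\in\mathbb{C}$, $Lv=\lambda v$ and $|\lambda|=R$, then there is a constant $\theta\in\mathbb{R}$ such that $e^{-i\theta}v$ is a unit. (c) $L$ has no eigenvalue $\lambda$ on the circle $|\lambda|=R$ except possibly $\lambda=R$. (d) If $R$ is an eigenvalue of $L$, then its algebraic multiplicity is $1$. (e) If moreover $f\in C^\alpha(\mathbb{T})$ for some $0<\alpha\le1$, then $L_\alpha$ is quasicompact, $r=R$, and $R$ is an eigenvalue of $L_\alpha$ of algebraic multiplicity $1$ with a unit eigenfunction.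
   Context: $\mathbb{T}=\mathbb{R}/\mathbb{Z}$ is identified with $[0,1]$ with $0$ and $1$ identified. $C(\mathbb{T})$ is the Banach space of continuous complex-valued functions on $\mathbb{T}$ with the maximum norm $\|\cdot\|_\infty$. A function $w\in C(\mathbb{T})$ is called a unit if $w(t)>0$ for all $t\in\mathbb{T}$. $L$ is called a Krein operator if, for every $u\in C(\mathbb{T})$ with $u\ge0$ everywhere and $u(t_0)>0$ for at least one $t_0\in\mathbb{T}$, there is $n\in\mathbb{N}$ (possibly depending on $u$) such that $L^nu$ is a unit. The limits defining $r$ and $R$ always exist (by super-/submultiplicativity of $\min L^n1$ and $\max L^n1$), and $R$ equals the spectral radius $\rho(L)$. For $0<\alpha\le1$, $C^\alpha(\mathbb{T})$ is the Banach space of H\''older continuous functions $u:\mathbb{T}\to\mathbb{C}$ with norm $\|u\|_\alpha=\sup_{s\ne t}\frac{|u(s)-u(t)|}{|s-t|^\alpha}+\|u\|_\infty$; if $f\in C^\alpha(\mathbb{T})$, then $L_\alpha:C^\alpha(\mathbb{T})\to C^\alpha(\mathbb{T})$, $L_\alpha u=Lu$, is a bounded linear operator. A bounded linear operator $T$ on a Banach space $X$ is quasicompact if there is a compact operator $K$ on $X$ with $\rho(T-K)<\rho(T)$, where $\rho$ denotes the spectral radius. *)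

(* Defs.v *)
From HB Require Import structures.
From mathcomp Require Import all_boot all_order all_algebra.
From mathcomp Require Import complex.
From mathcomp Require Import all_classical all_reals all_analysis.
From mathcomp Require Import ring lra.

Set Implicit Arguments.
Unset Strict Implicit.
Unset Printing Implicit Defensive.

Import Order.TTheory GRing.Theory Num.Theory.
Import numFieldNormedType.Exports.
Import ComplexField.Normc.

Local Open Scope classical_set_scope.
Local Open Scope ring_scope.
Local Open Scope complex_scope.

(* The norm of a [normedModType R[i]] takes its values in [R[i]]; the real
   modulus is [normc z : R], and [`|z| = (normc z)%:C] by definition. *)
HB.instance Definition _ (R : realType) :=
  NormedModule.copy R[i] (R[i] : numClosedFieldType)^o.
HB.instance Definition _ (R : realType) := Num.ClosedField.on R[i].

Section ComplexModulus.
Variable R : realType.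
Implicit Types z w : R[i].

Lemma normc_norm z : `|z| = (normc z)%:C. Proof. by []. Qed.

Lemma normc_ge0 z : 0 <= normc z.
Proof. by rewrite -lecR -normc_norm normr_ge0. Qed.

Lemma ler_normcD z w : normc (z + w) <= normc z + normc w.
Proof. by rewrite -lecR rmorphD /= -!normc_norm ler_normD. Qed.

Lemma normc_opp z : normc (- z) = normc z.
Proof. by apply: complexI; rewrite -!normc_norm normrN. Qed.

Lemma normc_distC z w : normc (z - w) = normc (w - z).
Proof. by rewrite -normc_opp opprB. Qed.

Lemma normc_real (x : R) : normc x%:C = `|x|.
Proof. by rewrite /= expr0n /= addr0 sqrtr_sqr. Qed.

Lemma normc_Re z : `|complex.Re z| <= normc z.
Proof.
case: z => a b /=; rewrite -sqrtr_sqr ler_sqrt ?addr_ge0 ?sqr_ge0 //.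
by rewrite lerDl sqr_ge0.
Qed.

Lemma normc_Im z : `|complex.Im z| <= normc z.
Proof.
case: z => a b /=; rewrite -sqrtr_sqr ler_sqrt ?addr_ge0 ?sqr_ge0 //.
by rewrite lerDr sqr_ge0.
Qed.

Lemma normc_le_ReIm z : normc z <= `|complex.Re z| + `|complex.Im z|.
Proof.
have -> : z = (complex.Re z)%:C + 'i * (complex.Im z)%:C by exact: complexE.
apply: le_trans (ler_normcD _ _) _; rewrite normcM normc_real.
have -> : normc ('i : R[i]) = 1 by rewrite /= expr0n /= add0r expr1n sqrtr1.
by rewrite mul1r normc_real -complexE.
Qed.

End ComplexModulus.

Section RealRadii.
Variables (R : realType) (X : normedModType R[i]).

Lemma gt0_complexE (e : R[i]) : 0 < e ->
  e = (complex.Re e)%:C /\ 0 < complex.Re e.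
Proof. by case: e => a b; rewrite ltcE /= => /andP[/eqP -> ->]. Qed.

Lemma cauchy_dist (F : set_system X) (e : R) : ProperFilter F -> cauchy F ->
  0 < e -> exists A, F A /\ forall u v, A u -> A v -> `|u - v| <= e%:C.
Proof.
move=> PF /cauchyP cF e0.
have e2 : 0 < (e / 2)%:C by rewrite ltcR divr_gt0.
have [x Fx] := cF _ e2; exists (ball x (e / 2)%:C); split=> // u v.
rewrite -!ball_normE /= => xu xv; rewrite (splitr e) rmorphD /=.
rewrite -(subrK x u) -addrA (le_trans (ler_normD _ _)) // lerD //.
  by rewrite distrC ltW.
exact: ltW.
Qed.

Lemma dist_cauchy (F : set_system X) : ProperFilter F ->
  (forall e : R, 0 < e ->
     exists A, F A /\ forall u v, A u -> A v -> `|u - v| <= e%:C) ->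
  cauchy F.
Proof.
move=> PF H; apply/cauchyP => e /gt0_complexE[-> e0].
have e2 : 0 < complex.Re e / 2 by rewrite divr_gt0.
have [A [FA HA]] := H _ e2.
have [x Ax] := filter_ex FA.
exists x; apply: filterS FA => y Ay; rewrite -ball_normE /=.
apply: le_lt_trans (HA _ _ Ax Ay) _.
by rewrite ltcR ltr_pdivrMr // ltr_pMr // ltr1n.
Qed.

Lemma dist_cvg (F : set_system X) (x : X) : Filter F ->
  (forall e : R, 0 < e ->
     exists A, F A /\ forall u, A u -> `|x - u| <= e%:C) -> F --> x.
Proof.
move=> FF H; apply/cvgrPdist_le => e /gt0_complexE[-> e0].
by have [A [FA HA]] := H _ e0; apply: filterS FA => y /HA.
Qed.

Lemma cvg_dist (F : set_system X) (x : X) (e : R) : Filter F -> F --> x ->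
  0 < e -> exists A, F A /\ forall u, A u -> `|x - u| <= e%:C.
Proof.
move=> FF /cvgrPdist_le Fx e0; exists [set u | `|x - u| <= e%:C]; split => //.
by apply: Fx; rewrite ltcR.
Qed.

End RealRadii.

Section ComplexComplete.
Variable R : realType.

Lemma complex_complete (F : set_system R[i]) :
  ProperFilter F -> cauchy F -> cvg F.
Proof.
move=> PF cF.
have part (p : R[i] -> R) : (forall z w, p (z - w) = p z - p w) ->
    (forall z, `|p z| <= normc z) -> cvg (p z @[z --> F]).
  move=> pB ple; apply: cauchy_cvg; apply/cauchyP => e e0.
  have [A [FA HA]] := cauchy_dist PF cF (divr_gt0 e0 (@ltr0n R 2)).
  have [x Ax] := filter_ex FA.
  exists (p x); rewrite /= nbhs_simpl /=; apply: filterS FA => y Ay.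
  rewrite -ball_normE /= -pB (le_lt_trans (ple _)) //.
  have := HA _ _ Ax Ay; rewrite normc_norm lecR => /le_lt_trans; apply.
  by rewrite ltr_pdivrMr // ltr_pMr // ltr1n.
have /cvg_ex[a Fa] := part (@complex.Re R)
  (fun '(a +i* b) '(c +i* d) => erefl) (@normc_Re R).
have /cvg_ex[b Fb] := part (@complex.Im R)
  (fun '(a +i* b) '(c +i* d) => erefl) (@normc_Im R).
apply/cvg_ex; exists (a +i* b); apply: dist_cvg => e e0.
have e2 : 0 < e / 2 by rewrite divr_gt0.
move/cvgrPdist_le : Fa => /(_ _ e2) Fa.
move/cvgrPdist_le : Fb => /(_ _ e2) Fb.
exists ([set z : R[i] | `|a - complex.Re z| <= e / 2] `&`
        [set z : R[i] | `|b - complex.Im z| <= e / 2]).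
split; first exact: filterI.
move=> [c d] /= [ac bd]; rewrite normc_norm lecR.
by apply: le_trans (normc_le_ReIm _) _; rewrite (splitr e) /= lerD.
Qed.

HB.instance Definition _ := Uniform_isComplete.Build R[i] complex_complete.

Lemma continuous_complexP (u : R -> R[i]) : continuous u <->
  forall t (e : R), 0 < e -> \forall s \near t, normc (u t - u s) <= e.
Proof.
split=> [cu t e e0|H t].
  have [A [FA HA]] := cvg_dist _ (cu t) e0.
  have {}FA : \forall s \near t, A (u s) := FA.
  by apply: filterS FA => s /HA; rewrite /= normc_norm lecR.
apply: dist_cvg => e e0; exists [set z | normc (u t - z) <= e]; split.
  exact: H.
by move=> z; rewrite normc_norm lecR.
Qed.

Lemma continuous_real_complex (f : R -> R) :
  continuous f -> continuous (fun t => (f t)%:C).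
Proof.
move=> cf; apply/continuous_complexP => t e e0.
move/cvgrPdist_le : (cf t) => /(_ _ e0); apply: filterS => s.
by rewrite -rmorphB normc_real.
Qed.

End ComplexComplete.

(* Supremum of a family of nonnegative reals; only used for bounded families,
   where [sup] is the actual supremum *)
Section SupFamily.
Variables (R : realType) (I : Type) (A : set I).
Implicit Types g h k : I -> R.

Definition sup_of g : R := sup [set g i | i in A].

Definition bounded_family g := exists M, forall i, A i -> g i <= M.

Lemma sup_of_ub g i : bounded_family g -> A i -> g i <= sup_of g.
Proof.
move=> [M gM] Ai; apply: ub_le_sup; last by exists i.
by exists M => _ [j Aj <-]; exact: gM.
Qed.

Hypothesis A0 : A !=set0.

Lemma sup_of_le g M : (forall i, A i -> g i <= M) -> sup_of g <= M.
Proof.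
move=> gM; apply: ge_sup; last by move=> _ [j Aj <-]; exact: gM.
by case: A0 => i Ai; exists (g i), i.
Qed.

Lemma sup_of_ge0 g : bounded_family g -> (forall i, 0 <= g i) -> 0 <= sup_of g.
Proof. by case: A0 => i Ai gb g0; exact: le_trans (g0 i) (sup_of_ub gb Ai). Qed.

Lemma sup_of_le_add g h k : bounded_family h -> bounded_family k ->
  (forall i, g i <= h i + k i) -> sup_of g <= sup_of h + sup_of k.
Proof.
move=> hb kb ghk; apply: sup_of_le => i Ai.
by rewrite (le_trans (ghk i)) // lerD // sup_of_ub.
Qed.

Lemma sup_of_scale (c : R) g h : 0 <= c -> bounded_family g ->
  (forall i, h i = c * g i) -> sup_of h = c * sup_of g.
Proof.
move=> c0 gb hE; apply/eqP; rewrite eq_le; apply/andP; split.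
  by apply: sup_of_le => i Ai; rewrite hE ler_wpM2l // sup_of_ub.
have hb : bounded_family h.
  by case: gb => M gM; exists (c * M) => i Ai; rewrite hE ler_wpM2l // gM.
have [cE|cn0] := eqVneq c 0.
  case: A0 => i Ai; rewrite cE mul0r.
  by apply: le_trans (sup_of_ub hb Ai); rewrite hE cE mul0r.
have c_gt0 : 0 < c by rewrite lt_def cn0.
rewrite mulrC -ler_pdivlMr //; apply: sup_of_le => i Ai.
by rewrite ler_pdivlMr // mulrC -hE sup_of_ub.
Qed.

End SupFamily.

(* C(T): functions on T = R/Z are the 1-periodic functions on the line *)
Definition contT_pred (R : realType) : {pred R -> R[i]} :=
  [pred u : R -> R[i] | `[< continuous u /\ periodic u 1 >]].

Record contT (R : realType) := ContT {
  contT_val :> R -> R[i];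
  contT_valP : contT_val \in @contT_pred R }.

HB.instance Definition _ (R : realType) := [isSub of contT R for @contT_val R].
HB.instance Definition _ (R : realType) := [Choice of contT R by <:].

Section ContT.
Variable R : realType.
Implicit Types u v : contT R.

Lemma contT_predP (u : R -> R[i]) :
  u \in @contT_pred R <-> continuous u /\ periodic u 1.
Proof. by split => [/asboolP|uP]; last exact/asboolP. Qed.

Lemma contT_continuous u : continuous u.
Proof. by have /contT_predP[] := contT_valP u. Qed.

Lemma contT_periodic u : periodic u 1.
Proof. by have /contT_predP[] := contT_valP u. Qed.

Lemma contT_submod_closed : submod_closed (@contT_pred R).
Proof.
split=> [|a u v /contT_predP[cu pu] /contT_predP[cv pv]]; apply/contT_predP.
  by split=> [|t //]; exact: cst_continuous.
split=> [t|t]; last by rewrite !fctE pu pv.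
by apply: cvgD; [exact: cvgZr (cu t)|exact: cv].
Qed.

HB.instance Definition _ :=
  GRing.isSubmodClosed.Build R[i] (R -> R[i]) (@contT_pred R)
    contT_submod_closed.
HB.instance Definition _ := [SubChoice_isSubLmodule of contT R by <:].

Lemma contTDE u v t : (u + v) t = u t + v t. Proof. by []. Qed.
Lemma contTNE u t : (- u) t = - u t. Proof. by []. Qed.
Lemma contTZE (a : R[i]) u t : (a *: u) t = a * u t. Proof. by []. Qed.
Lemma contT0E t : (0 : contT R) t = 0. Proof. by []. Qed.

Lemma contTP u v : u =1 v -> u = v.
Proof. by move=> uv; exact/val_inj/funext. Qed.

Lemma normc_continuous : continuous (@normc R : R[i] -> R).
Proof.
move=> z; apply/(@cvgrPdist_le _ _ _ (nbhs z)) => e e0.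
have e0' : 0 < e%:C by rewrite ltcR.
apply: filterS (nbhsx_ballx z _ e0') => w.
rewrite -ball_normE /= => /ltW; rewrite normc_norm lecR; apply: le_trans.
rewrite ler_norml; apply/andP; split.
  by rewrite lerNl opprB lerBlDr normc_distC -{1}(subrK z w) ler_normcD.
by rewrite lerBlDr -{1}(subrK w z) ler_normcD.
Qed.

Lemma contT_int u (m : int) t : u (t + m%:~R) = u t.
Proof.
have pn := periodicn (contT_periodic u).
case: m => n; first by rewrite -pmulrn pn.
by rewrite NegzE mulrNz -pmulrn -[LHS](pn n.+1) subrK.
Qed.

Lemma contT_bounded u : bounded_family setT (fun t => normc (u t)).
Proof.
have cu : {within `[0, 1 : R], continuous (fun t => normc (u t))}.
  apply: continuous_subspaceT => t; apply: continuous_comp.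
    exact: contT_continuous.
  exact: normc_continuous.
have [c _ Hc] := EVT_max ler01 cu.
exists (normc (u c)) => t _.
rewrite -(contT_int u (- Num.floor t)); apply: Hc.
rewrite in_itv /= mulrNz subr_ge0 floor_le /=.
by rewrite lerBlDr addrC ltW // -[X in _ + X]/(1%:~R) -intrD floorD1_gt.
Qed.

Definition sup_norm u : R := sup_of setT (fun t => normc (u t)).

Lemma setT_nonempty : [set: R] !=set0. Proof. by exists 0. Qed.

Lemma normc_le_sup_norm u t : normc (u t) <= sup_norm u.
Proof. exact: sup_of_ub (contT_bounded u) _. Qed.

Lemma sup_norm_le u M : (forall t, normc (u t) <= M) -> sup_norm u <= M.
Proof. by move=> uM; apply: (sup_of_le setT_nonempty) => t _; exact: uM. Qed.

Lemma sup_normD u v : sup_norm (u + v) <= sup_norm u + sup_norm v.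
Proof.
apply: (sup_of_le_add setT_nonempty (contT_bounded u) (contT_bounded v)) => t.
by rewrite contTDE ler_normcD.
Qed.

Lemma sup_normZ (a : R[i]) u : sup_norm (a *: u) = normc a * sup_norm u.
Proof.
apply: (sup_of_scale setT_nonempty (normc_ge0 a) (contT_bounded u)) => t.
by rewrite contTZE normcM.
Qed.

Lemma sup_norm_eq0 u : sup_norm u = 0 -> u = 0.
Proof.
move=> u0; apply: contTP => t; apply: eq0_normc; apply/eqP.
by rewrite eq_le normc_ge0 andbT -u0 normc_le_sup_norm.
Qed.

Let norm u : R[i] := (sup_norm u)%:C.

Let normD u v : norm (u + v) <= norm u + norm v.
Proof. by rewrite -rmorphD lecR sup_normD. Qed.

Let normZ (a : R[i]) u : norm (a *: u) = `|a| * norm u.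
Proof. by rewrite /norm sup_normZ rmorphM. Qed.

Let norm_eq0 u : norm u = 0 -> u = 0.
Proof. by move=> /complexI /sup_norm_eq0. Qed.

HB.instance Definition _ :=
  Lmodule_isNormed.Build R[i] (contT R) normD normZ norm_eq0.

Lemma contT_normE u : `|u| = (sup_norm u)%:C. Proof. by []. Qed.

Lemma contT_complete (F : set_system (contT R)) :
  ProperFilter F -> cauchy F -> cvg F.
Proof.
move=> PF cF.
have ev_cvg t : cvg ((fun u : contT R => u t) @ F).
  apply: cauchy_cvg; apply: dist_cauchy => e e0.
  have [A [FA HA]] := cauchy_dist PF cF e0.
  exists [set u t | u in A]; split.
    by rewrite /= nbhs_simpl /=; apply: filterS FA => u Au; exists u.
  move=> _ _ [u Au <-] [v Av <-].
  apply: le_trans (HA _ _ Au Av); rewrite contT_normE normc_norm lecR.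
  by have := normc_le_sup_norm (u - v) t.
pose g t : R[i] := lim ((fun u : contT R => u t) @ F).
have g_dist (e : R) : 0 < e ->
    exists A, F A /\ forall u, A u -> forall t, normc (g t - u t) <= e.
  move=> e0; have [A [FA HA]] := cauchy_dist PF cF e0.
  exists A; split=> // u Au t; apply/ler_addgt0Pr => r r0.
  have [B [FB HB]] := cvg_dist _ (ev_cvg t) r0.
  have {}FB : F [set v | B (v t)] by exact: FB.
  have [v [Av /= Bv]] := filter_ex (filterI FA FB).
  rewrite -(subrK (v t) (g t)) -addrA (le_trans (ler_normcD _ _)) //.
  rewrite [e + r]addrC lerD //; last first.
    have := HA _ _ Av Au; rewrite contT_normE lecR; apply: le_trans.
    by have := normc_le_sup_norm (v - u) t.
  by have := HB _ Bv; rewrite normc_norm lecR.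
have gP : g \in @contT_pred R.
  apply/contT_predP; split; last first.
    move=> t; rewrite /g (_ : (fun u : contT R => u (t + 1)) = fun u => u t) //.
    by apply/funext => u; exact: contT_periodic.
  apply/continuous_complexP => t e e0.
  have e3 : 0 < e / 3 by rewrite divr_gt0.
  have [A [FA HA]] := g_dist _ e3; have [u Au] := filter_ex FA.
  have /continuous_complexP/(_ t _ e3) := @contT_continuous u.
  apply: filterS => s us.
  have -> : g t - g s = (g t - u t) + (u t - u s) + (u s - g s).
    by rewrite !addrA !subrK.
  have -> : e = e / 3 + e / 3 + e / 3 by field.
  rewrite (le_trans (ler_normcD _ _)) // lerD //; last first.
    by rewrite normc_distC HA.
  by rewrite (le_trans (ler_normcD _ _)) // lerD // HA.
apply/cvg_ex; exists (ContT gP); apply: dist_cvg => e e0.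
have [A [FA HA]] := g_dist _ e0; exists A; split=> // u Au.
by rewrite contT_normE lecR; apply: sup_norm_le => t; exact: HA.
Qed.

HB.instance Definition _ :=
  Uniform_isComplete.Build (contT R) contT_complete.

End ContT.

(* C^alpha(T): since its elements are 1-periodic, the supremum over all real
   s <> t is the one computed with the distance of T *)
Section Hoelder.
Variable R : realType.
Implicit Types (alpha : R) (u v : contT R).

Definition off_diagonal : set (R * R) := [set p | p.1 != p.2].

Definition hoelder_quotient alpha (u : R -> R[i]) (p : R * R) : R :=
  normc (u p.1 - u p.2) / `|p.1 - p.2| `^ alpha.

Definition hoelder_pred alpha : {pred contT R} :=
  [pred u : contT R | `[< bounded_family off_diagonal
                                         (hoelder_quotient alpha u) >]].

Definition hoelder_seminorm alpha u : R :=
  sup_of off_diagonal (hoelder_quotient alpha u).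

End Hoelder.

Record hoelderT (R : realType) (alpha : R) := HoelderT {
  hoelderT_val :> contT R;
  hoelderT_valP : hoelderT_val \in hoelder_pred alpha }.

HB.instance Definition _ (R : realType) (alpha : R) :=
  [isSub of hoelderT alpha for @hoelderT_val R alpha].
HB.instance Definition _ (R : realType) (alpha : R) :=
  [Choice of hoelderT alpha by <:].

Section HoelderT.
Variables (R : realType) (alpha : R).
Local Notation A := (@off_diagonal R).
Implicit Types u v : hoelderT alpha.

Lemma hoelder_predP (u : contT R) : u \in hoelder_pred alpha <->
  exists M, forall s t, s != t -> normc (u s - u t) <= M * `|s - t| `^ alpha.
Proof.
have pw (s t : R) : s != t -> 0 < `|s - t| `^ alpha.
  by move=> st; apply: powR_gt0; rewrite normr_gt0 subr_eq0.
split=> [/asboolP[M uM]|[M uM]]; last apply/asboolP; exists M.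
  by move=> s t st; rewrite -ler_pdivrMr ?pw //; exact: (uM (s, t)).
by move=> [s t] /= st; rewrite /hoelder_quotient ler_pdivrMr ?pw // uM.
Qed.

Lemma hoelder_submod_closed : submod_closed (hoelder_pred alpha).
Proof.
split=> [|a u v /hoelder_predP[M uM] /hoelder_predP[N vN]];
  apply/hoelder_predP.
  by exists 0 => s t _; rewrite !contT0E subrr normc0 mul0r.
exists (normc a * M + N) => s t st.
rewrite !contTDE !contTZE opprD addrACA -mulrBr mulrDl.
rewrite (le_trans (ler_normcD _ _)) // lerD ?vN // normcM -mulrA.
by rewrite ler_wpM2l ?normc_ge0 // uM.
Qed.

HB.instance Definition _ :=
  GRing.isSubmodClosed.Build R[i] (contT R) (hoelder_pred alpha)
    hoelder_submod_closed.
HB.instance Definition _ := [SubChoice_isSubLmodule of hoelderT alpha by <:].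

Lemma hoelderT_bounded u : bounded_family A (hoelder_quotient alpha u).
Proof. exact/asboolP/(hoelderT_valP u). Qed.

Lemma off_diagonal_nonempty : A !=set0.
Proof. by exists (0, 1); rewrite /off_diagonal /= eq_sym oner_neq0. Qed.

Lemma hoelder_quotient_ge0 u p : 0 <= hoelder_quotient alpha u p.
Proof. by rewrite divr_ge0 ?normc_ge0 ?powR_ge0. Qed.

Lemma hoelder_seminorm_ge0 u : 0 <= hoelder_seminorm alpha u.
Proof.
exact: (sup_of_ge0 off_diagonal_nonempty (hoelderT_bounded u)
  (hoelder_quotient_ge0 u)).
Qed.

Lemma hoelder_seminormD u v : hoelder_seminorm alpha (u + v) <=
  hoelder_seminorm alpha u + hoelder_seminorm alpha v.
Proof.
apply: (sup_of_le_add off_diagonal_nonempty (hoelderT_bounded u)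
  (hoelderT_bounded v)) => -[s t].
rewrite /hoelder_quotient -mulrDl ler_wpM2r ?invr_ge0 ?powR_ge0 //=.
by rewrite opprD addrACA ler_normcD.
Qed.

Lemma hoelder_seminormZ (a : R[i]) u :
  hoelder_seminorm alpha (a *: u) = normc a * hoelder_seminorm alpha u.
Proof.
apply: (sup_of_scale off_diagonal_nonempty (normc_ge0 a)
  (hoelderT_bounded u)) => -[s t].
by rewrite /hoelder_quotient mulrA -normcM mulrBr.
Qed.

Lemma sup_norm_ge0 (u : contT R) : 0 <= sup_norm u.
Proof. exact: le_trans (normc_ge0 _) (normc_le_sup_norm u 0). Qed.

Definition hoelder_norm u : R := hoelder_seminorm alpha u + sup_norm u.

Let norm u : R[i] := (hoelder_norm u)%:C.

Let normD u v : norm (u + v) <= norm u + norm v.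
Proof.
by rewrite -rmorphD lecR addrACA lerD ?hoelder_seminormD ?sup_normD.
Qed.

Let normZ (a : R[i]) u : norm (a *: u) = `|a| * norm u.
Proof.
by rewrite /norm /hoelder_norm hoelder_seminormZ sup_normZ -mulrDr rmorphM.
Qed.

Let norm_eq0 u : norm u = 0 -> u = 0.
Proof.
move=> /complexI /eqP; rewrite paddr_eq0 ?hoelder_seminorm_ge0 ?sup_norm_ge0 //.
by move=> /andP[_ /eqP /sup_norm_eq0 u0]; exact: val_inj.
Qed.

HB.instance Definition _ :=
  Lmodule_isNormed.Build R[i] (hoelderT alpha) normD normZ norm_eq0.

Lemma hoelderT_normE u : `|u| = (hoelder_norm u)%:C. Proof. by []. Qed.

Lemma hoelder_seminorm_le (u : hoelderT alpha) M :
  (forall s t : R, s != t -> normc (u s - u t) <= M * `|s - t| `^ alpha) ->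
  hoelder_seminorm alpha u <= M.
Proof.
move=> uM; apply: (sup_of_le off_diagonal_nonempty) => -[s t] /= st.
rewrite /hoelder_quotient ler_pdivrMr ?uM //=.
by apply: powR_gt0; rewrite normr_gt0 subr_eq0.
Qed.

Lemma normc_le_hoelder_seminorm u (s t : R) : s != t ->
  normc (u s - u t) <= hoelder_seminorm alpha u * `|s - t| `^ alpha.
Proof.
move=> st; rewrite -ler_pdivrMr.
  exact: (@sup_of_ub _ _ _ _ (s, t) (hoelderT_bounded u)).
by apply: powR_gt0; rewrite normr_gt0 subr_eq0.
Qed.

Lemma hoelderT_complete (F : set_system (hoelderT alpha)) :
  ProperFilter F -> cauchy F -> cvg F.
Proof.
move=> PF cF.
have : cvg (@hoelderT_val R alpha @ F).
  apply: cauchy_cvg; apply: dist_cauchy => e e0.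
  have [A [FA HA]] := cauchy_dist PF cF e0.
  exists [set hoelderT_val u | u in A]; split.
    by rewrite /= nbhs_simpl /=; apply: filterS FA => u Au; exists u.
  move=> _ _ [u Au <-] [v Av <-]; apply: le_trans (HA _ _ Au Av).
  rewrite contT_normE hoelderT_normE lecR /hoelder_norm lerDr.
  exact: hoelder_seminorm_ge0.
move=> /cvg_ex[/= G FG].
have G_dist (e : R) : 0 < e -> exists A, F A /\ forall u, A u ->
    sup_norm (G - u) <= e /\
    forall s t : R, s != t ->
      normc ((G - u) s - (G - u) t) <= e * `|s - t| `^ alpha.
  move=> e0; have [A [FA HA]] := cauchy_dist PF cF e0.
  have [B [FB HB]] := cvg_dist _ FG e0.
  have {}FB : F [set u | B (hoelderT_val u)] by exact: FB.
  exists (A `&` [set u | B (hoelderT_val u)]); split; first exact: filterI.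
  move=> u [Au /HB]; rewrite contT_normE lecR => Gu; split=> // s t st.
  apply/ler_addgt0Pr => r r0.
  have [C [FC HC]] := cvg_dist _ FG (divr_gt0 r0 (@ltr0n R 2)).
  have {}FC : F [set u | C (hoelderT_val u)] by exact: FC.
  have [v [Av /= /HC]] := filter_ex (filterI FA FC).
  rewrite contT_normE lecR => Gv.
  have -> : (G - u) s - (G - u) t =
      ((v - u) s - (v - u) t) + ((G - v) s - (G - v) t).
    by rewrite !contTDE !contTNE /=; ring.
  rewrite (le_trans (ler_normcD _ _)) // lerD //.
    rewrite (le_trans (normc_le_hoelder_seminorm _ st)) //.
    rewrite ler_wpM2r ?powR_ge0 //.
    have := HA _ _ Av Au; rewrite hoelderT_normE lecR; apply: le_trans.
    by rewrite /hoelder_norm lerDl sup_norm_ge0.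
  rewrite (splitr r) (le_trans (ler_normcD _ _)) // normc_opp.
  by rewrite lerD // (le_trans (normc_le_sup_norm _ _)).
have GP : G \in hoelder_pred alpha.
  have [A [FA HA]] := G_dist _ (@ltr01 R); have [u Au] := filter_ex FA.
  rewrite -(subrK (hoelderT_val u) G) rpredD ?(hoelderT_valP u) //.
  by apply/hoelder_predP; exists 1; exact: (HA _ Au).2.
apply/cvg_ex; exists (HoelderT GP); apply: dist_cvg => e e0.
have [A [FA HA]] := G_dist _ (divr_gt0 e0 (@ltr0n R 2)).
exists A; split=> // u /HA[Gu Guh].
rewrite hoelderT_normE lecR (splitr e) lerD //.
exact: hoelder_seminorm_le.
Qed.

HB.instance Definition _ :=
  Uniform_isComplete.Build (hoelderT alpha) hoelderT_complete.

End HoelderT.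

(* Bounded operators on a complex Banach space; [T] bounded linear is
   [T : {linear X -> X}] with [continuous T] *)
Section OperatorTheory.
Variables (R : realType) (X : completeNormedModType R[i]).

Definition spectrum (T : X -> X) : set R[i] :=
  [set lambda | ~ exists S : {linear X -> X},
     [/\ continuous S,
         forall x, S (lambda *: x - T x) = x &
         forall x, lambda *: S x - T (S x) = x]].

(* As a supremum in \bar R, it needs no boundedness of the spectrum *)
Definition spectral_radius (T : X -> X) : \bar R :=
  ereal_sup [set (normc lambda)%:E | lambda in spectrum T].

Definition compact_operator (K : {linear X -> X}) :=
  precompact (K @` [set x | `|x| <= 1]).

Definition quasicompact (T : {linear X -> X}) :=
  continuous T /\
  exists2 K : {linear X -> X}, compact_operator K &
    (spectral_radius (fun x : X => (T x - K x)%R) < spectral_radius T)%E.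

End OperatorTheory.

Section Eigenvalues.
Variables (R : realType) (V : lmodType R[i]).
Implicit Types (T : V -> V) (lambda : R[i]).

Definition is_eigenvalue T lambda := exists2 v, v != 0 & T v = lambda *: v.

Definition generalized_eigenspace T lambda : set V :=
  [set u | exists n, iter n (fun w => T w - lambda *: w) u = 0].

Definition has_dimension (E : set V) (m : nat) :=
  exists e : 'I_m -> V,
    (forall c : 'I_m -> R[i], \sum_i c i *: e i = 0 -> forall i, c i = 0) /\
    E = [set \sum_i c i *: e i | c in [set: 'I_m -> R[i]]].

Definition has_algebraic_multiplicity T lambda (m : nat) :=
  has_dimension (generalized_eigenspace T lambda) m.

End Eigenvalues.

Section CircleFunctions.
Variable R : realType.

Lemma real_contT_subproof (f : R -> R) : continuous f -> periodic f 1 ->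
  (fun t => (f t)%:C) \in @contT_pred R.
Proof.
move=> cf pf; apply/contT_predP; split; first exact: continuous_real_complex.
by move=> t; rewrite pf.
Qed.

Definition real_contT (f : R -> R) (cf : continuous f) (pf : periodic f 1) :
  contT R := ContT (real_contT_subproof cf pf).

Definition one_contT : contT R :=
  real_contT (@cst_continuous R R 1) (fun=> erefl).

(* In the order of [R[i]], [0 < z] means that z is real and positive *)
Definition is_unit (w : contT R) := forall t, 0 < w t.

Definition circle_min (u : contT R) : R :=
  inf [set complex.Re (u t) | t in [set: R]].

Definition circle_max (u : contT R) : R :=
  sup [set complex.Re (u t) | t in [set: R]].

Definition krein (T : contT R -> contT R) :=
  forall u : contT R, (forall t, 0 <= u t) -> (exists t0, 0 < u t0) ->
  exists n, is_unit (iter n T u).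

Definition lower_rate (T : contT R -> contT R) : R :=
  limn (fun n => circle_min (iter n T one_contT) `^ n%:R^-1).

Definition upper_rate (T : contT R -> contT R) : R :=
  limn (fun n => circle_max (iter n T one_contT) `^ n%:R^-1).

Definition cexpi (theta : R) : R[i] := cos theta +i* sin theta.

End CircleFunctions.

Section TransferOperator.
Variables (R : realType) (d : nat).
Implicit Types g u : contT R.

Definition transfer_fun (g u : R -> R[i]) (t : R) : R[i] :=
  d%:R^-1 * \sum_(i < d) g ((t + i%:R) / d%:R) * u ((t + i%:R) / d%:R).

Lemma transfer_fun_periodic g u : periodic (transfer_fun g u) 1.
Proof.
move=> t; rewrite /transfer_fun; congr (_ * _).
case: d => [|n]; first by rewrite !big_ord0.
rewrite big_ord_recr [RHS]big_ord_recl /= addrC; congr (_ + _).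
  have -> : (t + 1 + n%:R) / n.+1%:R = (t + 0%:R) / n.+1%:R + 1.
    by rewrite addr0 -addrA -natr1 [1 + _]addrC mulrDl divff // natr1 pnatr_eq0.
  by rewrite !contT_periodic.
apply: eq_bigr => i _.
by have -> : t + (bump 0 i)%:R = t + 1 + i%:R by rewrite -addrA nat1r.
Qed.

Lemma transfer_subproof g u : transfer_fun g u \in @contT_pred R.
Proof.
apply/contT_predP; split; last exact: transfer_fun_periodic.
move=> t; apply: cvgM; first exact: cvg_cst.
apply: cvg_big => [|i _]; first exact: add_continuous.
have ct : (fun s : R => (s + i%:R) / d%:R) @ t --> (t + i%:R) / d%:R.
  by apply: cvgM (cvg_cst _); apply: cvgD (cvg_cst _); exact: cvg_id.
by apply: cvgM; apply: cvg_comp ct _; exact: contT_continuous.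
Qed.

Definition transfer g u : contT R := ContT (transfer_subproof g u).

Lemma transfer_is_linear g : linear (transfer g).
Proof.
move=> a u v; apply: contTP => t.
have E w : transfer g w t = transfer_fun g w t by [].
rewrite contTDE contTZE !E /transfer_fun mulrCA -mulrDr; congr (_ * _).
rewrite mulr_sumr -big_split; apply: eq_bigr => i _.
by rewrite contTDE contTZE mulrDr mulrCA.
Qed.

HB.instance Definition _ g :=
  GRing.isLinear.Build R[i] (contT R) (contT R) *:%R (transfer g)
    (transfer_is_linear g).

Variable alpha : R.

Lemma transfer_hoelder_subproof (g u : hoelderT alpha) :
  transfer g u \in hoelder_pred alpha.
Proof.
apply/hoelder_predP.
pose H := sup_norm g * hoelder_seminorm alpha u +
          sup_norm u * hoelder_seminorm alpha g.
have prodH (s t : R) : s != t ->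
    normc (g s * u s - g t * u t) <= H * `|s - t| `^ alpha.
  move=> st.
  have -> : g s * u s - g t * u t = g s * (u s - u t) + u t * (g s - g t).
    by ring.
  rewrite (le_trans (ler_normcD _ _)) // !normcM mulrDl -!mulrA.
  by rewrite lerD // ler_pM ?normc_ge0 ?normc_le_sup_norm
             ?normc_le_hoelder_seminorm.
exists (normc (d%:R^-1 : R[i]) * (\sum_(i < d) H * d%:R^-1 `^ alpha)).
move=> s t st; rewrite /= /transfer_fun -mulrBr normcM -mulrA.
rewrite ler_wpM2l ?normc_ge0 // -sumrB mulr_suml.
elim/big_ind2: _ => [|x X y Y xX yY|i _]; first by rewrite normc0.
  by rewrite (le_trans (ler_normcD _ _)) // lerD.
have d0 : d%:R != 0 :> R by rewrite pnatr_eq0 -lt0n (leq_ltn_trans _ (ltn_ord i)).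
have -> : H * d%:R^-1 `^ alpha * `|s - t| `^ alpha =
    H * `|(s + i%:R) / d%:R - (t + i%:R) / d%:R| `^ alpha.
  rewrite -mulrA -powRM ?invr_ge0 //; congr (_ * _ `^ _).
  rewrite -mulrBl opprD addrACA subrr addr0 normrM mulrC; congr (_ * _).
  by rewrite ger0_norm ?invr_ge0.
apply: prodH; apply: contra st => /eqP /(mulIf (invr_neq0 d0)) /addIr ->.
exact: eqxx.
Qed.

Definition hoelder_transfer (g u : hoelderT alpha) : hoelderT alpha :=
  HoelderT (transfer_hoelder_subproof g u).

Lemma hoelder_transfer_is_linear (g : hoelderT alpha) : linear (hoelder_transfer g).
Proof. by move=> a u v; apply: val_inj; exact: (transfer_is_linear g). Qed.

HB.instance Definition _ (g : hoelderT alpha) :=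
  GRing.isLinear.Build R[i] (hoelderT alpha) (hoelderT alpha) *:%R
    (hoelder_transfer g) (hoelder_transfer_is_linear g).

End TransferOperator.

(* Main.v *)
(* Write L for the transfer operator and rho for its growth rate, the limit of
   (max L^n 1)^(1/n). If u >= 0 is nonzero and L u >= rho u, then L u = rho u:
   otherwise the Krein property makes L^n (L u - rho u) bounded below by a
   positive constant, so that some function grows faster than rho^n. For an
   eigenfunction v with |lambda| = rho this applies to u = |v|, which is then
   positive, and the triangle inequality in the definition of L v is an
   equality. Hence the phase chi = v / |v| satisfies
   L^n (chi h) = mu^n chi L^n h for every h, with mu = lambda / rho; taking for h
   a bump around a point s and n with L^n h > 0, mu^n chi is everywhere close
   to chi s, so that chi is constant. This gives (b), (c) and (d).

   For Hoelder f, the Lasota-Yorke inequality bounds the Hoelder constants of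
   the partial sums h_N of the resolvent series at rho by their maxima, which
   are unbounded. A limit u of h_N / max h_N along an ultrafilter satisfies
   L u >= rho u, so it is a positive Hoelder eigenfunction. Conjugating by u
   gives an operator T with T 1 = 1. The Krein property, made uniform by
   finitely many bumps, and the Lasota-Yorke inequality show that T contracts
   oscillations and Hoelder constants at a geometric rate. The operator of rank
   one K v = (L v 0 / u 0) u satisfies
   (L - K)^n v = L^n v - (L^n v 0 / u 0) u for n >= 1, so the spectral radius of
   L - K is smaller than rho. *)
From HB Require Import structures.
Require Import Defs.
From mathcomp Require Import all_boot all_order all_algebra.
From mathcomp Require Import complex.
From mathcomp Require Import all_classical all_reals all_analysis.
From mathcomp Require Import zify ring lra.
Import Order.TTheory GRing.Theory Num.Theory.
Import numFieldNormedType.Exports.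
Import ComplexField.Normc.
Local Open Scope classical_set_scope.
Local Open Scope ring_scope.
Local Open Scope complex_scope.

Set Implicit Arguments.
Unset Strict Implicit.
Unset Printing Implicit Defensive.

(** * Growth rates *)

Section RealSequences.
Variable R : realType.

(** Writing the root as [expR (ln C / n)] reduces the limit to continuity of [expR] at [0]. It makes
    constant prefactors harmless when roots are taken. *)
Lemma cvg_root (C : R) : 0 < C -> C `^ n%:R^-1 @[n --> \oo] --> (1 : R).
Proof.
move=> C0.
have -> : (fun n : nat => C `^ n%:R^-1) = (fun n : nat => expR (n%:R^-1 * ln C)).
  by apply/funext => n; rewrite /powR gt_eqF.
have V : n%:R^-1 @[n --> \oo] --> (0 : R).
  apply/(@gtr0_cvgV0 _ _ _ _ (fun n : nat => n%:R : R)); last exact: cvgr_idn.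
  by near=> n; rewrite ltr0n; near: n; exists 1%N.
have H : n%:R^-1 * ln C @[n --> \oo] --> 0.
  by rewrite -(mul0r (ln C)); apply: cvgM V _; exact: cvg_cst.
by rewrite -[X in _ --> X]expR0; exact: (continuous_cvg _ (@continuous_expR R 0) H).
Unshelve. all: by end_near. Qed.

Lemma exprn_root (x : R) n : 0 <= x -> (x `^ n.+1%:R^-1) ^+ n.+1 = x.
Proof.
by move=> x0; rewrite -powR_mulrn ?powR_ge0 // -powRrM mulVf ?pnatr_eq0 // powRr1.
Qed.

Lemma root_exprn (x : R) n : 0 <= x -> (x ^+ n.+1) `^ n.+1%:R^-1 = x.
Proof.
by move=> x0; rewrite -powR_mulrn // -powRrM mulfV ?pnatr_eq0 // powRr1.
Qed.

Lemma exp_dominates (x C y : R) : 1 < x -> 0 < y -> exists n, C < y * x ^+ n.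
Proof.
move=> x1 y0; have x0 : 0 < x by exact: lt_trans x1.
have C0 : 0 < `|C| + 1 by rewrite ltr_wpDl.
have : `|x^-1| < 1.
  by rewrite normfV gtr0_norm // invf_lt1.
move=> /(cvg_geometric (1 : R))/cvgrPdist_lt/(_ _ (divr_gt0 y0 C0))[n _ /(_ n (leqnn n))] /=.
rewrite /geometric /= mul1r sub0r normrN normrX normfV gtr0_norm // exprVn.
rewrite ltr_pdivlMr // mulrC ltr_pdivrMr ?exprn_gt0 // => H.
by exists n; rewrite (le_lt_trans _ H) // ler_wpDr // ler_norm.
Qed.

(* Fekete's lemma in multiplicative form; the limit is the infimum of the
   roots, hence the lower bound for every [n]. *)
Lemma submultiplicative_root_cvg (B : nat -> R) (c : R) : 0 < c ->
  (forall n, c ^+ n <= B n) -> (forall m n, B (m + n)%N <= B m * B n) ->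
  exists rho : R, [/\ B n `^ n%:R^-1 @[n --> \oo] --> rho,
    c <= rho, forall n, rho ^+ n <= B n &
    forall s, rho < s -> exists2 C : R, 0 < C & forall n, B n <= C * s ^+ n].
Proof.
move=> c0 cB subB.
have B0 n : 0 < B n by apply: lt_le_trans (cB n); exact: exprn_gt0.
(* The family starts at index [1]: for [n = 0] the exponent [0^-1] is [0] and the root has the
   default value [1]. *)
pose E := [set B n.+1 `^ n.+1%:R^-1 | n in [set: nat]].
have Ec : lbound E c.
  move=> _ [n _ <-]; rewrite -[leLHS](root_exprn n (ltW c0)).
  by rewrite ge0_ler_powR ?invr_ge0 ?nnegrE ?exprn_ge0 // ltW.
have E0 : E !=set0 by exists (B 1%N `^ 1%:R^-1), 0%N.
have infE : has_inf E by split=> //; exists c.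
pose rho := inf E.
have crho : c <= rho by exact: lb_le_inf.
have rho0 : 0 < rho by exact: lt_le_trans crho.
have rhoB n : rho ^+ n.+1 <= B n.+1.
  rewrite -[leRHS](exprn_root n (ltW (B0 _))).
  rewrite lerXn2r ?nnegrE ?powR_ge0 ?(ltW rho0) //.
  by apply: inf_lbound; [exists c|exists n].
have Bs s : rho < s -> exists2 C : R, 0 < C & forall n, B n <= C * s ^+ n.
  move=> rs; have s0 : 0 < s by exact: lt_trans rs.
  have [_ [m _ <-]] := inf_adherent (etrans (subr_gt0 _ _) rs) infE.
  rewrite -/rho addrC subrK => Bms.
  have {}Bms : B m.+1 <= s ^+ m.+1.
    rewrite -[leLHS](exprn_root m (ltW (B0 _))).
    by rewrite lerXn2r ?nnegrE ?powR_ge0 ?(ltW s0) // ltW.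
  (* An index is cut into blocks of length [m.+1], each costing at most [s ^+ m.+1]; [C] absorbs the
     remainder, which is at most [m]. *)
  pose C := \sum_(j < m.+1) B j / s ^+ j.
  have CB (j : nat) : (j < m.+1)%N -> B j <= C * s ^+ j.
    move=> jm; rewrite -ler_pdivrMr ?exprn_gt0 // /C (bigD1 (Ordinal jm)) //=.
    by rewrite lerDl sumr_ge0 // => i _; rewrite divr_ge0 ?exprn_ge0 // ltW.
  exists C; first by apply: lt_le_trans (B0 0%N) _; rewrite -[C]mulr1 CB.
  move=> n; rewrite (divn_eq n m.+1).
  elim: (n %/ m.+1)%N => [|q IH]; first by rewrite mul0n add0n CB // ltn_mod.
  rewrite mulSn -addnA (le_trans (subB _ _)) // exprD mulrCA.
  by rewrite ler_pM // ltW.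
exists rho; split=> //; last first.
  case=> [|n]; last exact: rhoB.
  by rewrite expr0 (le_trans _ (cB 0%N)) ?expr0.
apply/cvgrPdist_le => e e0.
(* With [s = rho + e / 2] the roots of [C * s ^+ n] tend to [s], hence are eventually at most
   [rho + e]. *)
have [C C0 CB] := Bs _ (ltr_pwDr (divr_gt0 e0 (ltr0n R 2)) (lexx rho)).
have s0 : 0 < rho + e / 2 by rewrite addr_gt0 // divr_gt0.
have : C `^ n%:R^-1 * (rho + e / 2) @[n --> \oo] --> 1 * (rho + e / 2).
  by apply: cvgM; [exact: cvg_root|exact: cvg_cst].
rewrite mul1r => /cvgrPdist_le/(_ _ (divr_gt0 e0 (ltr0n R 2))) Cs.
near=> n; have n0 : (0 < n)%N by near: n; exists 1%N.
have [k nk] : exists k, n = k.+1 by case: (n) n0 => // k _; exists k.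
have lo : rho <= B n `^ n%:R^-1.
  by rewrite nk; apply: inf_lbound; [exists c|exists k].
have up : B n `^ n%:R^-1 <= C `^ n%:R^-1 * (rho + e / 2).
  rewrite -[X in _ * X](root_exprn k (ltW s0)) -nk -powRM ?exprn_ge0 ?(ltW C0) ?(ltW s0) //.
  apply: ge0_ler_powR; rewrite ?invr_ge0 ?nnegrE ?mulr_ge0 ?exprn_ge0 ?(ltW s0) ?(ltW C0) //; exact: ltW.
have := near Cs n; rewrite distrC ler_norml => /(_ _) /andP[//|_ up2].
rewrite distrC ger0_norm ?subr_ge0 //; lra.
Unshelve. all: by end_near. Qed.

End RealSequences.

(** * Real transfer operators *)

Section RealTransfer.
Variables (R : realType) (d : nat).
Implicit Types (g u v : R -> R) (U : contT R).

(** The real counterpart of [transfer_fun]. A real weight acts separately on real and imaginary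
    parts, and order arguments are carried out on this operator. *)
Definition rtransfer g u (t : R) : R :=
  d%:R^-1 * \sum_(i < d) g ((t + i%:R) / d%:R) * u ((t + i%:R) / d%:R).

Lemma rtransfer_comb g a b u v :
  rtransfer g (fun t => a * u t + b * v t) =
  fun t => a * rtransfer g u t + b * rtransfer g v t.
Proof.
apply/funext => t; rewrite /rtransfer !(mulrCA _ d%:R^-1) -mulrDr.
congr (_ * _); rewrite !mulr_sumr -big_split; apply: eq_bigr => i _ /=.
by rewrite mulrDr !(mulrCA (g _)).
Qed.

Lemma iter_rtransfer_comb g n a b u v :
  iter n (rtransfer g) (fun t => a * u t + b * v t) =
  fun t => a * iter n (rtransfer g) u t + b * iter n (rtransfer g) v t.
Proof. by elim: n => // n IH; rewrite iterS IH rtransfer_comb. Qed.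

Lemma iter_rtransferZ g n a u :
  iter n (rtransfer g) (fun t => a * u t) =
  fun t => a * iter n (rtransfer g) u t.
Proof.
have -> : (fun t => a * u t) = (fun t => a * u t + 0 * u t).
  by apply/funext => t; rewrite mul0r addr0.
by rewrite iter_rtransfer_comb; apply/funext => t; rewrite mul0r addr0.
Qed.

Lemma rtransferZ g a u :
  rtransfer g (fun t => a * u t) = fun t => a * rtransfer g u t.
Proof. exact: (iter_rtransferZ g 1). Qed.

Lemma rtransfer_le g u v : (forall t, 0 <= g t) -> (forall t, u t <= v t) ->
  forall t, rtransfer g u t <= rtransfer g v t.
Proof.
move=> g0 uv t; rewrite ler_wpM2l ?invr_ge0 // ler_sum // => i _.
by rewrite ler_wpM2l.
Qed.

Lemma iter_rtransfer_le g n u v :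
  (forall t, 0 <= g t) -> (forall t, u t <= v t) ->
  forall t, iter n (rtransfer g) u t <= iter n (rtransfer g) v t.
Proof. by move=> g0 uv; elim: n => // n IH t; exact: rtransfer_le. Qed.

Lemma iter_rtransfer_ge0 g n u :
  (forall t, 0 <= g t) -> (forall t, 0 <= u t) ->
  forall t, 0 <= iter n (rtransfer g) u t.
Proof.
move=> g0 u0; elim: n => // n IH t.
rewrite iterS {1}/rtransfer.
by rewrite mulr_ge0 ?invr_ge0 // sumr_ge0 // => i _; rewrite mulr_ge0.
Qed.

Lemma iter_rtransfer_le_cst g n u a : (forall t, 0 <= g t) ->
  (forall t, u t <= a) ->
  forall t, iter n (rtransfer g) u t <= a * iter n (rtransfer g) (fun=> 1) t.
Proof.
move=> g0 ua t; have := iter_rtransferZ g n a (fun=> 1).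
move=> /(congr1 (@^~ t)) /= <-; apply: iter_rtransfer_le => // s.
by rewrite mulr1.
Qed.

Lemma iter_rtransfer_ge_cst g n u a : (forall t, 0 <= g t) ->
  (forall t, a <= u t) ->
  forall t, a * iter n (rtransfer g) (fun=> 1) t <= iter n (rtransfer g) u t.
Proof.
move=> g0 ua t; have := iter_rtransferZ g n a (fun=> 1).
move=> /(congr1 (@^~ t)) /= <-; apply: iter_rtransfer_le => // s.
by rewrite mulr1.
Qed.

Lemma iter_rtransfer_geZ g n a u : (forall t, 0 <= g t) -> 0 <= a ->
  (forall t, a * u t <= rtransfer g u t) ->
  forall t, a ^+ n * u t <= iter n (rtransfer g) u t.
Proof.
move=> g0 a0 au; elim: n => [|n IH] t; first by rewrite expr0 mul1r.
rewrite exprSr -mulrA (le_trans (ler_wpM2l (exprn_ge0 _ a0) (au t))) //.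
have := rtransfer_le g0 IH t; rewrite rtransferZ; exact.
Qed.

Lemma iter_rtransfer_leZ g n a u : (forall t, 0 <= g t) -> 0 <= a ->
  (forall t, rtransfer g u t <= a * u t) ->
  forall t, iter n (rtransfer g) u t <= a ^+ n * u t.
Proof.
move=> g0 a0 au; elim: n => [|n IH] t; first by rewrite expr0 mul1r.
rewrite exprSr -mulrA.
apply: le_trans (ler_wpM2l (exprn_ge0 _ a0) (au t)).
have := rtransfer_le g0 IH t; rewrite rtransferZ; exact.
Qed.

Lemma iter_rtransfer_eigen g n a u : rtransfer g u = (fun t => a * u t) ->
  iter n (rtransfer g) u = fun t => a ^+ n * u t.
Proof.
move=> uE; elim: n => [|n IH]; first by apply/funext => t; rewrite expr0 mul1r.
by rewrite iterS IH rtransferZ uE; apply/funext => t; rewrite exprSr mulrA.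
Qed.

Lemma Re_sum (I : Type) (r : seq I) (P : pred I) (F : I -> R[i]) :
  complex.Re (\sum_(i <- r | P i) F i) = \sum_(i <- r | P i) complex.Re (F i).
Proof. by elim/big_rec2: _ => // i x y _ <-; case: (F i); case: y. Qed.

Lemma Im_sum (I : Type) (r : seq I) (P : pred I) (F : I -> R[i]) :
  complex.Im (\sum_(i <- r | P i) F i) = \sum_(i <- r | P i) complex.Im (F i).
Proof. by elim/big_rec2: _ => // i x y _ <-; case: (F i); case: y. Qed.

Lemma ReZ (a : R) (z : R[i]) : complex.Re (a%:C * z) = a * complex.Re z.
Proof. by case: z => x y /=; rewrite mul0r subr0. Qed.

Lemma ImZ (a : R) (z : R[i]) : complex.Im (a%:C * z) = a * complex.Im z.
Proof. by case: z => x y /=; rewrite mul0r addr0. Qed.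

Lemma complex_natV : d%:R^-1 = (d%:R^-1)%:C :> R[i].
Proof. by rewrite fmorphV rmorph_nat. Qed.

Lemma Re_transfer_fun g (U : R -> R[i]) t :
  complex.Re (transfer_fun d (fun t => (g t)%:C) U t) =
  rtransfer g (fun t => complex.Re (U t)) t.
Proof.
rewrite /transfer_fun complex_natV ReZ Re_sum; congr (_ * _).
by apply: eq_bigr => i _; rewrite ReZ.
Qed.

Lemma Im_transfer_fun g (U : R -> R[i]) t :
  complex.Im (transfer_fun d (fun t => (g t)%:C) U t) =
  rtransfer g (fun t => complex.Im (U t)) t.
Proof.
rewrite /transfer_fun complex_natV ImZ Im_sum; congr (_ * _).
by apply: eq_bigr => i _; rewrite ImZ.
Qed.

Lemma normc_sum (I : Type) (r : seq I) (P : pred I) (F : I -> R[i]) :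
  normc (\sum_(i <- r | P i) F i) <= \sum_(i <- r | P i) normc (F i).
Proof.
elim/big_rec2: _ => [|i x y _ xy]; first by rewrite normc0.
by rewrite (le_trans (ler_normcD _ _)) // lerD.
Qed.

Lemma normc_transfer_fun g (U : R -> R[i]) t : (forall t, 0 <= g t) ->
  normc (transfer_fun d (fun t => (g t)%:C) U t) <=
  rtransfer g (fun t => normc (U t)) t.
Proof.
move=> g0; rewrite /transfer_fun complex_natV normcM normc_real.
rewrite ger0_norm ?invr_ge0 // ler_wpM2l ?invr_ge0 //.
rewrite (le_trans (normc_sum _ _ _)) // ler_sum // => i _.
by rewrite normcM normc_real ger0_norm.
Qed.

Lemma normc_iter_transfer_fun g n (U : R -> R[i]) t : (forall t, 0 <= g t) ->
  normc (iter n (transfer_fun d (fun t => (g t)%:C)) U t) <=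
  iter n (rtransfer g) (fun t => normc (U t)) t.
Proof.
move=> g0; elim: n t => // n IH t.
rewrite (le_trans (normc_transfer_fun _ _ g0)) //; exact: rtransfer_le.
Qed.

Lemma Re_iter_transfer_fun g n (U : R -> R[i]) :
  (fun t => complex.Re (iter n (transfer_fun d (fun t => (g t)%:C)) U t)) =
  iter n (rtransfer g) (fun t => complex.Re (U t)).
Proof.
elim: n => // n IH.
by apply/funext => t; rewrite iterS Re_transfer_fun IH.
Qed.

Lemma Im_iter_transfer_fun g n (U : R -> R[i]) :
  (fun t => complex.Im (iter n (transfer_fun d (fun t => (g t)%:C)) U t)) =
  iter n (rtransfer g) (fun t => complex.Im (U t)).
Proof.
elim: n => // n IH.
by apply/funext => t; rewrite iterS Im_transfer_fun IH.
Qed.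

Lemma iter_transfer_val (W U : contT R) n :
  iter n (transfer d W) U = iter n (transfer_fun d W) U :> (R -> R[i]).
Proof. by elim: n => // n IH; exact: (congr1 (transfer_fun d W) IH). Qed.

Lemma iter_transfer_fun_real g n u :
  iter n (transfer_fun d (fun t => (g t)%:C)) (fun t => (u t)%:C) =
  (fun t => (iter n (rtransfer g) u t)%:C).
Proof.
have H := Re_iter_transfer_fun g n (fun t => (u t)%:C).
have K := Im_iter_transfer_fun g n (fun t => (u t)%:C).
apply/funext => t; apply/eqP; rewrite eq_complex /=.
rewrite (congr1 (@^~ t) H) (congr1 (@^~ t) K) /= eqxx /=.
have := iter_rtransferZ g n 0 (fun=> 0).
have -> : (fun t : R => 0 * 0) = (fun=> 0) :> (R -> R).
  by apply/funext => s; rewrite mul0r.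
by move=> /(congr1 (@^~ t)) /= ->; rewrite mul0r.
Qed.

(** The real-valued counterpart of [contT], kept as a predicate so that estimates apply to plain
    functions. *)
Definition cper u := continuous u /\ periodic u 1.

Lemma continuous_lipschitz_comp (p : R[i] -> R) U :
  (forall z w, `|p z - p w| <= normc (z - w)) -> cper (fun t => p (U t)).
Proof.
move=> pl; split; last by move=> t; rewrite contT_periodic.
move=> t; apply/cvgrPdist_le => e e0.
have /continuous_complexP/(_ t _ e0) := @contT_continuous _ U.
by apply: filterS => s; apply: le_trans.
Qed.

Lemma cper_Re U : cper (fun t => complex.Re (U t)).
Proof.
apply: continuous_lipschitz_comp => z w.
by apply: le_trans (normc_Re (z - w)); case: z => ? ?; case: w.
Qed.

Lemma cper_Im U : cper (fun t => complex.Im (U t)).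
Proof.
apply: continuous_lipschitz_comp => z w.
by apply: le_trans (normc_Im (z - w)); case: z => ? ?; case: w.
Qed.

Lemma cper_normc U : cper (fun t => normc (U t)).
Proof.
apply: continuous_lipschitz_comp => z w; rewrite ler_norml lerNl opprB.
have A := ler_normcD (z - w) w; have B := ler_normcD (w - z) z.
rewrite !subrK in A B; rewrite normc_distC in B.
by apply/andP; split; lra.
Qed.

Lemma cper_cst a : cper (fun=> a).
Proof. by split=> [|t //]; exact: cst_continuous. Qed.

Lemma cper_comb a b u v : cper u -> cper v -> cper (fun t => a * u t + b * v t).
Proof.
move=> [cu pu] [cv pv]; split=> t; last by rewrite pu pv.
by apply: cvgD; (apply: cvgM; first exact: cvg_cst); [exact: cu|exact: cv].
Qed.

Lemma cper_rtransfer g u : cper g -> cper u -> cper (rtransfer g u).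
Proof.
move=> [cg pg] [cu pu].
suff -> : rtransfer g u =
    fun t => complex.Re (transfer d (real_contT cg pg) (real_contT cu pu) t).
  exact: cper_Re.
by apply/funext => t; rewrite /= Re_transfer_fun.
Qed.

Lemma cper_iter g n u : cper g -> cper u -> cper (iter n (rtransfer g) u).
Proof. by move=> cg cu; elim: n => // n IH; exact: cper_rtransfer. Qed.

Lemma cper_int u (m : int) t : periodic u 1 -> u (t + m%:~R) = u t.
Proof.
move=> pu; have pn := periodicn pu.
case: m => n; first by rewrite -pmulrn pn.
by rewrite NegzE mulrNz -pmulrn -[LHS](pn n.+1) subrK.
Qed.

Lemma floor_itv01 (t : R) : t + (- Num.floor t)%:~R \in `[0, 1].
Proof.
rewrite in_itv /= mulrNz subr_ge0 floor_le /=.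
by rewrite lerBlDr addrC ltW // -[X in _ + X]/(1%:~R) -intrD floorD1_gt.
Qed.

(** Periodicity reduces the supremum to [[0, 1]]. The location of the maximum point is recorded
    because such points are later passed to a limit and compared with a grid. *)
Lemma cper_max u : cper u -> exists2 t0, t0 \in `[0, 1] & forall t, u t <= u t0.
Proof.
move=> [cu pu].
have [c c01 Hc] := EVT_max ler01 (continuous_subspaceT cu).
by exists c => // t; rewrite -(cper_int (- Num.floor t) t pu) Hc ?floor_itv01.
Qed.

Lemma cper_min u : cper u -> exists t0, forall t, u t0 <= u t.
Proof.
move=> [cu pu].
have [c c01 Hc] := EVT_min ler01 (continuous_subspaceT cu).
by exists c => t; rewrite -(cper_int (- Num.floor t) t pu) Hc ?floor_itv01.
Qed.

Lemma cper_gt0 u : cper u -> (forall t, 0 < u t) ->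
  exists2 c : R, 0 < c & forall t, c <= u t.
Proof. by move=> /cper_min[t0 Ht] u0; exists (u t0). Qed.

Lemma cper_bounded u : cper u -> exists2 M : R, 0 < M & forall t, `|u t| <= M.
Proof.
move=> cu; have [a _ aP] := cper_max cu; have [b bP] := cper_min cu.
exists (`|u a| + `|u b| + 1) => [|t]; first by rewrite ltr_wpDl ?addr_ge0.
have := aP t; have := bP t; have := ler_norm (u a).
have := ler_norm (- u b); rewrite normrN ler_norml.
have := normr_ge0 (u a); have := normr_ge0 (u b); lra.
Qed.

End RealTransfer.

(** * The Krein property *)

Section Tent.
Variable R : realType.
Implicit Types (h s t : R) (k : int).

(* The supremum over [k] makes the tent of half-width [h] periodic. *)
Definition tent h t : R :=
  sup_of setT (fun k : int => Num.max 0 (h - `|t - k%:~R|)).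

Let setTint : [set: int] !=set0. Proof. by exists 0. Qed.

Let tentb h t : 0 <= h ->
  bounded_family setT (fun k : int => Num.max 0 (h - `|t - k%:~R|)).
Proof. by move=> h0; exists h => k _; rewrite ge_max h0 /= gerBl. Qed.

Lemma tent_le h t : 0 <= h -> tent h t <= h.
Proof.
by move=> h0; apply: (sup_of_le setTint) => k _; rewrite ge_max h0 /= gerBl.
Qed.

Lemma tent_ge0 h t : 0 <= h -> 0 <= tent h t.
Proof.
by move=> h0; apply: (sup_of_ge0 setTint (tentb t h0)) => k; rewrite le_max lexx.
Qed.

Lemma tent_ge h t k : 0 <= h -> h - `|t - k%:~R| <= tent h t.
Proof.
move=> h0; apply: le_trans (sup_of_ub (tentb t h0) (I : setT k)).
by rewrite le_max lexx orbT.
Qed.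

Lemma tent_gt0 h t : 0 < tent h t -> exists k, `|t - k%:~R| < h.
Proof.
move=> t0; apply: contrapT => /forallNP H; move: t0; rewrite ltNge => /negP; apply.
apply: (sup_of_le setTint) => k _; rewrite ge_max lexx /= subr_le0.
by rewrite leNgt; apply/negP/H.
Qed.

Lemma tent_lip h s t : 0 <= h -> tent h s <= tent h t + `|s - t|.
Proof.
move=> h0; apply: (sup_of_le setTint) => k _; rewrite ge_max addr_ge0 ?tent_ge0 //=.
have := tent_ge t k h0; have := ler_normD (t - s) (s - k%:~R).
by rewrite addrA subrK (distrC t s); lra.
Qed.

Lemma cper_tent h p : 0 <= h -> cper (fun t => tent h (t - p)).
Proof.
move=> h0; split=> t.
  apply/cvgrPdist_le => e e0; apply: filterS (nbhsx_ballx t e e0) => s.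
  rewrite -ball_normE /= => /ltW E.
  have H := tent_lip (t - p) (s - p) h0; have K := tent_lip (s - p) (t - p) h0.
  move: H K; rewrite !opprB !addrA !subrK.
  rewrite (distrC s t) ler_norml; lra.
apply/le_anti/andP; split; apply: (sup_of_le setTint) => k _;
  rewrite ge_max tent_ge0 //=.
  have := tent_ge (t - p) (k - 1) h0; rewrite rmorphB /=.
  congr (_ - `|_| <= _); ring.
have := tent_ge (t + 1 - p) (k + 1) h0; rewrite rmorphD /=; congr (_ - `|_| <= _); ring.
Qed.

(** An integer within [1/4] of [-1/2] would lie strictly between [-1] and [0]. *)
Lemma tent_half t : tent 4^-1 (t - (t + 2^-1)) = 0.
Proof.
apply/eqP; rewrite eq_le tent_ge0 // ?invr_ge0 // andbT leNgt.
apply/negP => /tent_gt0[k]; rewrite opprD addrA subrr sub0r ltr_norml => /andP[A B].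
have k0 : k < 0 by rewrite -(ltr_int R); lra.
have k1 : -1 < k by rewrite -(ltr_int R) rmorphN1; lra.
by move: k0 k1; lia.
Qed.

End Tent.

(** * Positivity and growth rate under the Krein property *)

Section KreinReal.
Variables (R : realType) (d : nat) (f : R -> R).
Hypotheses (cf : cper f) (f0 : forall t, 0 <= f t).
Local Notation L := (rtransfer d f).
Implicit Types u v : R -> R.

Hypothesis krL : forall u, cper u -> (forall t, 0 <= u t) ->
  (exists t, 0 < u t) -> exists n, forall t, 0 < iter n L u t.

Let c1 : cper (fun=> 1 : R) := cper_cst 1.

(** If [L 1] vanished at [t], so would [L v] for every nonnegative bounded [v]. A tent centred half
    a period away from [t] would then be zero at [t] under all iterates, including the zeroth. *)
Lemma krein_transfer1_gt0 t : 0 < L (fun=> 1) t.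
Proof.
rewrite ltNge; apply/negP => Lt0.
have h0 : 0 <= 4^-1 :> R by rewrite invr_ge0.
pose u s : R := tent 4^-1 (s - (t + 2^-1)).
have cu : cper u by exact: cper_tent.
have u0 s : 0 <= u s by exact: tent_ge0.
have [|n /(_ t)] := krL cu u0.
  exists (t + 2^-1); have := tent_ge (t + 2^-1 - (t + 2^-1)) 0 h0.
  rewrite subrr mulr0z subr0 normr0 subr0 => Lh.
  by rewrite /u subrr (lt_le_trans _ Lh) // invr_gt0.
case: n => [|n] /=; first by rewrite /u tent_half ltxx.
have [M M0 uM] := cper_bounded (cper_iter d n cf cu).
rewrite ltNge => /negP; apply.
have := @iter_rtransfer_le_cst _ d f 1 _ M f0
  (fun s => le_trans (ler_norm _) (uM s)) t.
by move=> /le_trans; apply; rewrite mulr_ge0_le0 // ltW.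
Qed.

Lemma krein_transfer1_ge : exists2 c : R, 0 < c & forall t, c <= L (fun=> 1) t.
Proof. exact: cper_gt0 (cper_rtransfer _ cf c1) krein_transfer1_gt0. Qed.

(** Once an iterate is positive, compactness bounds it below by a positive constant, and [L 1 > 0]
    carries positivity to the next iterate. *)
Lemma krein_iter_ge u : cper u -> (forall t, 0 <= u t) -> (exists t, 0 < u t) ->
  exists n, forall m, (n <= m)%N ->
    exists2 c : R, 0 < c & forall t, c <= iter m L u t.
Proof.
move=> cu u0 uN; have [n Hn] := krL cu u0 uN; exists n => m nm.
apply: cper_gt0; first exact: cper_iter.
rewrite -(subnK nm); elim: (m - n)%N => // k IH t.
have [c c0 cH] := cper_gt0 (cper_iter d (k + n) cf cu) IH.
apply: lt_le_trans (@iter_rtransfer_ge_cst _ d f 1 _ c f0 cH t).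
by rewrite mulr_gt0 // krein_transfer1_gt0.
Qed.

Let B n : R := sup (range (iter n L (fun=> 1))).

Let iter1_le n t : iter n L (fun=> 1) t <= B n.
Proof.
apply: ub_le_sup; last by exists t.
have [M _ HM] := cper_bounded (cper_iter d n cf c1).
by exists M => _ [s _ <-]; rewrite (le_trans (ler_norm _)).
Qed.

(** Submultiplicativity of [B] follows by applying the positive operator [L^m] to [L^n 1 <= B n],
    and [L 1 >= c] keeps the limit positive. Later arguments know [rho] only through the two
    comparisons returned here. *)
Lemma transfer_growth_rate : exists rho : R,
  [/\ B n `^ n%:R^-1 @[n --> \oo] --> rho,
      0 < rho,
      forall n b, (forall t, iter n L (fun=> 1) t <= b) -> rho ^+ n <= b &
      forall s, rho < s ->
        exists2 C : R, 0 < C & forall n t, iter n L (fun=> 1) t <= C * s ^+ n].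
Proof.
have [c c0 cL] := krein_transfer1_ge.
have rangeN n : range (iter n L (fun=> 1)) !=set0 by eexists; exists 0.
have cB n : c ^+ n <= B n.
  apply: le_trans (iter1_le n 0).
  have cL1 t : c * 1 <= L (fun=> 1) t by rewrite mulr1.
  by have := iter_rtransfer_geZ n f0 (ltW c0) cL1 0; rewrite mulr1.
have B0 n : 0 <= B n by apply: le_trans (cB n); rewrite exprn_ge0 // ltW.
have sB m n : B (m + n)%N <= B m * B n.
  apply: ge_sup => // _ [t _ <-]; rewrite iterD mulrC.
  apply: le_trans (iter_rtransfer_le_cst d m f0 (iter1_le n) t) _.
  by rewrite ler_wpM2l // iter1_le.
have [rho [Bcvg crho rhoB Brho]] := submultiplicative_root_cvg c0 cB sB.
exists rho; split=> //; first exact: lt_le_trans crho.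
- move=> n b Hb; apply: le_trans (rhoB n) _.
  by apply: ge_sup => // _ [t _ <-].
- move=> s /Brho[C C0 HC]; exists C => // n t.
  exact: le_trans (iter1_le n t) (HC n).
Qed.

Variable rho : R.
Hypotheses (rho0 : 0 < rho)
  (Lrho : forall s, rho < s ->
     exists2 C : R, 0 < C & forall n t, iter n L (fun=> 1) t <= C * s ^+ n).

(* Otherwise the Krein property makes a power of [L] applied to the defect
   uniformly positive, so that some [v >= 0] grows faster than [rho]. *)
Lemma krein_subeigen u : cper u -> (forall t, 0 <= u t) ->
  (exists t, 0 < u t) -> (forall t, rho * u t <= L u t) ->
  L u = fun t => rho * u t.
Proof.
move=> cu u0 uN uL; apply: contrapT => NE.
pose z t := 1 * L u t + (- rho) * u t.
have z0 t : 0 <= z t by rewrite /z mul1r mulNr subr_ge0.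
have cz : cper z by apply: cper_comb => //; exact: cper_rtransfer.
have zN : exists t, 0 < z t.
  apply: contrapT => /forallNP zle; apply: NE; apply/funext => t.
  have /negP := zle t; rewrite -leNgt => zt.
  by have := z0 t; have {zt} := zt; rewrite /z; lra.
have [n /(_ n (leqnn _))[c c_gt0 cz1]] := krein_iter_ge cz z0 zN.
pose v := iter n L u.
have v0 t : 0 <= v t by exact: iter_rtransfer_ge0.
have zE : iter n L z = fun t => 1 * L v t + (- rho) * v t.
  by rewrite /z iter_rtransfer_comb -iterSr.
have vL t : c + rho * v t <= L v t by have := cz1 t; rewrite zE; lra.
have cv : cper v by exact: cper_iter.
have [M M0 vM] := cper_bounded cv.
have {}vM t : v t <= M by rewrite (le_trans (ler_norm _)).
have cM : 0 < c / M by rewrite divr_gt0.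
(* Since [v <= M], the constant gain [c] dominates [c / M * v], which turns it into a larger growth
   factor. *)
have vsup t : (rho + c / M) * v t <= L v t.
  apply: le_trans (vL t); rewrite mulrDl addrC lerD2r.
  by rewrite mulrAC ler_pdivrMr // ler_wpM2l // ltW.
have [t0 vt0] : exists t, 0 < v t.
  apply: contrapT => /forallNP vle.
  have vz t : v t = 0.
    by apply/eqP; rewrite eq_le v0 andbT leNgt; apply/negP/vle.
  have := vL 0; rewrite vz mulr0 addr0; apply/negP; rewrite -ltNge.
  by rewrite /rtransfer big1 ?mulr0 // => i _; rewrite vz mulr0.
(* The intermediate rate [rho + c / M / 2] exceeds [rho], so it bounds [L^n 1], but lies below the
   rate at which [v] grows. *)
have [C C0 CL] := @Lrho (rho + c / M / 2) ltac:(by rewrite ltrDl divr_gt0).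
have s0 : 0 < rho + c / M / 2 by rewrite addr_gt0 ?divr_gt0.
have [k] := @exp_dominates _ ((rho + c / M) / (rho + c / M / 2)) (M * C) (v t0)
  ltac:(by rewrite ltr_pdivlMr // mul1r; lra) vt0.
apply/negP; rewrite -leNgt expr_div_n mulrA ler_pdivrMr ?exprn_gt0 //.
rewrite mulrC (le_trans (iter_rtransfer_geZ k f0 _ vsup t0)) //.
  by rewrite addr_ge0 // ltW.
apply: le_trans (iter_rtransfer_le_cst d k f0 vM t0) _.
by rewrite -[leRHS]mulrA ler_wpM2l ?CL // ltW.
Qed.

Lemma krein_eigen_ge u : cper u -> (forall t, 0 <= u t) ->
  (exists t, 0 < u t) -> L u = (fun t => rho * u t) ->
  exists2 c : R, 0 < c & forall t, c <= u t.
Proof.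
move=> cu u0 uN uL.
have [n /(_ n (leqnn _))[c c_gt0]] := krein_iter_ge cu u0 uN.
rewrite (iter_rtransfer_eigen n uL) => cuL.
exists (c / rho ^+ n) => [|t]; first by rewrite divr_gt0 // exprn_gt0.
by rewrite ler_pdivrMr ?exprn_gt0 // mulrC.
Qed.

End KreinReal.

(** * The peripheral spectrum *)

Section Circle.
Variable R : realType.

Lemma cexpi_surj (z : R[i]) : normc z = 1 -> exists theta : R, z = cexpi theta.
Proof.
case: z => a b /= /(congr1 (fun x => x ^+ 2)).
rewrite sqr_sqrtr ?addr_ge0 ?sqr_ge0 // expr1n => ab.
have a1 : -1 <= a <= 1.
  rewrite -ler_norml -(@ler_pXn2r _ 2) ?nnegrE // real_normK ?num_real // expr1n.
  by rewrite -ab lerDl sqr_ge0.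
have ca : cos (acos a) = a by apply: acosK; rewrite in_itv.
have sa : sin (acos a) = `|b|.
  by rewrite sin_acos // -ab addrC addKr sqrtr_sqr.
have [b0|b0] := leP 0 b.
  by exists (acos a); rewrite /cexpi ca sa ger0_norm.
by exists (- acos a); rewrite /cexpi cosN sinN ca sa ltr0_norm // opprK.
Qed.

Lemma cexpiNM (theta : R) : cexpi (- theta) * cexpi theta = 1.
Proof.
rewrite /cexpi cosN sinN; apply/eqP; rewrite eq_complex /=.
rewrite mulNr opprK -!expr2 cos2Dsin2 eqxx /= mulNr mulrC subrr; exact: eqxx.
Qed.

Lemma normcV (z : R[i]) : normc z^-1 = (normc z)^-1.
Proof. by apply: complexI; rewrite fmorphV -!normc_norm normfV. Qed.

Lemma normcX (z : R[i]) n : normc (z ^+ n) = normc z ^+ n.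
Proof. by apply: complexI; rewrite rmorphXn -!normc_norm normrX. Qed.

Lemma normc_eq0 (z : R[i]) : (normc z == 0) = (z == 0).
Proof. by rewrite -(inj_eq (@complexI _)) -normc_norm normr_eq0. Qed.

End Circle.

Section Peripheral.
Variables (R : realType) (d : nat) (f : R -> R).
Hypotheses (d_gt0 : (0 < d)%N) (cf : continuous f) (f0 : forall t, 0 <= f t)
  (pf : periodic f 1).
Let w : contT R := real_contT cf pf.
Local Notation L := (transfer d w).
Local Notation Lr := (rtransfer d f).
Hypothesis krL : krein L.

Lemma krein_real (u : R -> R) : cper u -> (forall t, 0 <= u t) ->
  (exists t, 0 < u t) -> exists n, forall t, 0 < iter n Lr u t.
Proof.
move=> [cu pu] u0 [t0 ut0].
have [|| n Hn] := krL (u := real_contT cu pu).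
- by move=> t; rewrite /= lecR.
- by exists t0; rewrite /= ltcR.
exists n => t; have := Hn t.
by rewrite iter_transfer_val /= iter_transfer_fun_real ltcR.
Qed.

Let cperf : cper f. Proof. by []. Qed.

Variable rho : R.
Hypotheses (rho0 : 0 < rho)
  (Lrho : forall s, rho < s ->
     exists2 C : R, 0 < C & forall n t, iter n Lr (fun=> 1) t <= C * s ^+ n).

Section Eigenfunction.
Variables (v : contT R) (lambda : R[i]).
Hypotheses (vN0 : v != 0) (Lv : L v = lambda *: v) (nlam : normc lambda = rho).

Let u t : R := normc (v t).

Let LvE t : transfer_fun d w v t = lambda * v t.
Proof. by rewrite -[LHS]/(L v t) Lv contTZE. Qed.

(** The triangle inequality gives [rho * u <= Lr u]; at the growth rate such a function is an
    eigenfunction. *)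
Lemma peripheral_modulus_eigen : Lr u = fun t => rho * u t.
Proof.
apply: (krein_subeigen cperf f0 krein_real rho0 Lrho).
- exact: cper_normc.
- by move=> t; exact: normc_ge0.
- apply: contrapT => /forallNP H; move/eqP: vN0; apply; apply: contTP => t.
  apply/eqP; rewrite -normc_eq0 eq_le normc_ge0 andbT leNgt.
  exact/negP/H.
- move=> t; rewrite -nlam -normcM -LvE; exact: normc_transfer_fun.
Qed.

Lemma peripheral_modulus_ge : exists2 c : R, 0 < c & forall t, c <= u t.
Proof.
apply: (krein_eigen_ge cperf f0 krein_real rho0).
- exact: cper_normc.
- by move=> t; exact: normc_ge0.
- apply: contrapT => /forallNP H; move/eqP: vN0; apply; apply: contTP => t.
  apply/eqP; rewrite -normc_eq0 eq_le normc_ge0 andbT leNgt.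
  exact/negP/H.
- exact: peripheral_modulus_eigen.
Qed.

Let u_gt0 t : 0 < u t.
Proof. by have [c c0 cu] := peripheral_modulus_ge; exact: lt_le_trans (cu t). Qed.

Let mu := lambda / rho%:C.
Let chi t := v t / (u t)%:C.

Let uN0 t : (u t)%:C != 0.
Proof. by rewrite (inj_eq (@complexI _) _ 0) gt_eqF. Qed.

Let rhoN0 : rho%:C != 0.
Proof. by rewrite (inj_eq (@complexI _) _ 0) gt_eqF. Qed.

Let normc_chi t : normc (chi t) = 1.
Proof.
by rewrite /chi normcM normcV normc_real -/(u t) gtr0_norm // divff // gt_eqF.
Qed.

Let normc_mu : normc mu = 1.
Proof.
by rewrite /mu normcM normcV normc_real gtr0_norm // nlam divff // gt_eqF.
Qed.

(* The moduli satisfy the same equation, so the triangle inequality for the sum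
   defining [L v] is an equality and its terms are aligned. *)
Let aligned t (i : 'I_d) (y := (t + i%:R) / d%:R) :
  (f y)%:C * v y = (f y * u y)%:C * (mu * chi t).
Proof.
pose Y (i : 'I_d) := (t + i%:R) / d%:R.
pose F (i : 'I_d) := (f (Y i))%:C * v (Y i).
have nF j : `|F j| = (f (Y j) * u (Y j))%:C.
  by rewrite normc_norm normcM normc_real ger0_norm.
have dN0 : d%:R != 0 :> R[i] by rewrite pnatr_eq0 -lt0n.
have sumF : \sum_i F i = d%:R * (lambda * v t).
  by rewrite -LvE /transfer_fun mulrA divff // mul1r.
have sumN : \sum_i `|F i| = d%:R * (rho * u t)%:C.
  have := congr1 (@^~ t) peripheral_modulus_eigen => /= <-.
  rewrite /rtransfer rmorphM /= -complex_natV mulrA divff // mul1r rmorph_sum /=.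
  by apply: eq_bigr => j _; rewrite nF.
(* The equality case of the triangle inequality gives one phase [z] common to all terms; comparing
   the two sums identifies it as [mu * chi t]. *)
have [|z _ Fz] := @normC_sum_eq R[i] _ xpredT F.
  by rewrite sumN sumF normrM normr_nat normc_norm normcM nlam.
have zE : z = mu * chi t.
  have : \sum_i F i = (\sum_i `|F i|) * z.
    by rewrite mulr_suml; apply: eq_bigr => j _; exact: Fz.
  rewrite sumF sumN -mulrA => /(mulfI dN0) E.
  rewrite /mu /chi mulrACA -invfM -rmorphM E mulrAC divff ?mul1r //.
  by rewrite rmorphM; exact: mulf_neq0 rhoN0 (uN0 t).
by rewrite -zE -[LHS]/(F i) Fz // nF.
Qed.

(** Under the weight [f], alignment replaces [chi] at every preimage of [t] by [mu * chi t], so the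
    bracket leaves the sum. The free coefficient [a] allows iteration, each step multiplying it by
    [mu]. *)
Let transfer_chi (a c : R[i]) (h : R -> R[i]) :
  transfer_fun d w (fun t => (a * chi t - c) * h t) =
  fun t => (a * mu * chi t - c) * transfer_fun d w h t.
Proof.
apply/funext => t; rewrite /transfer_fun mulrCA; congr (_ * _).
rewrite mulr_sumr; apply: eq_bigr => i _ /=.
set y := (t + i%:R) / d%:R.
have E : (f y)%:C * chi y = (f y)%:C * (mu * chi t).
  by rewrite {1}/chi mulrA aligned rmorphM /= -/y mulrAC (mulfK (uN0 y)).
have -> : (f y)%:C * ((a * chi y - c) * h y) =
  (a * ((f y)%:C * chi y) - c * (f y)%:C) * h y by ring.
by rewrite E; ring.
Qed.

Let iter_transfer_chi n (c : R[i]) (h : R -> R[i]) :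
  iter n (transfer_fun d w) (fun t => (chi t - c) * h t) =
  fun t => (mu ^+ n * chi t - c) * iter n (transfer_fun d w) h t.
Proof.
elim: n => [|n IH]; first by apply/funext => t; rewrite expr0 mul1r.
by rewrite iterS IH transfer_chi exprSr.
Qed.

Let continuous_chi : continuous chi.
Proof.
have cV : continuous (fun s => ((u s)^-1)%:C : R[i]).
  apply: continuous_real_complex => s; apply: cvgV; first by rewrite gt_eqF.
  exact: (cper_normc v).1.
have -> : chi = fun s => v s * ((u s)^-1)%:C.
  by apply/funext => s; rewrite /chi fmorphV.
by move=> t; apply: cvgM; [exact: contT_continuous|exact: cV].
Qed.

(** A tent [H] at [s0] lives where [chi] is within [e] of [chi s0]. Applying [L^n] to
    [(chi - chi s0) * H] and dividing by [L^n H > 0] spreads this closeness to every [t], at the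
    price of the rotation [z = mu ^+ n]. *)
Let chi_near (e : R) (s0 : R) : 0 < e -> exists2 z : R[i], normc z = 1 &
  forall t, normc (z * chi t - chi s0) <= e.
Proof.
move=> e0; have /continuous_complexP/(_ s0 _ e0) := continuous_chi.
move=> /nbhs_ballP[h /= h0 Hh].
have chi_int t (k : int) : chi (t + k%:~R) = chi t.
  by rewrite /chi /u contT_int.
pose H t : R := tent h (t - s0).
have cH : cper H by apply: cper_tent; exact: ltW.
have H0 t : 0 <= H t by apply: tent_ge0; exact: ltW.
have HN : exists t, 0 < H t.
  exists s0; rewrite /H subrr; apply: lt_le_trans (tent_ge 0 0 (ltW h0)).
  by rewrite mulr0z subr0 normr0 subr0.
have chiH t : normc ((chi t - chi s0) * (H t)%:C) <= e * H t.
  rewrite normcM normc_real (ger0_norm (H0 t)).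
  have [Ht|] := ltP 0 (H t); last first.
    by move=> Ht; have -> : H t = 0 by [apply/eqP; rewrite eq_le Ht H0]; rewrite !mulr0.
  rewrite ler_pM2r //; have [k Hk] := tent_gt0 Ht.
  rewrite normc_distC -(chi_int t (- k)); apply: Hh; rewrite -ball_normE /=.
  by rewrite rmorphN /= distrC; apply: le_lt_trans Hk; rewrite addrAC.
have [n Hn] := krein_real cH H0 HN.
exists (mu ^+ n) => [|t]; first by rewrite normcX normc_mu expr1n.
rewrite -(ler_pM2r (Hn t)) -{1}(ger0_norm (ltW (Hn t))) -normc_real -normcM.
have /= <- := congr1 (@^~ t) (iter_transfer_fun_real d f n H).
have /= <- := congr1 (@^~ t)
  (iter_transfer_chi n (chi s0) (fun t => (H t)%:C)).
apply: le_trans (normc_iter_transfer_fun d n _ t f0) _.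
have /= <- := congr1 (@^~ t) (iter_rtransferZ d f n e H).
exact: iter_rtransfer_le.
Qed.

Lemma peripheral_eigenfunction :
  exists2 theta, (forall t, v t = cexpi theta * (normc (v t))%:C) &
    forall t, 0 < normc (v t).
Proof.
have chiE t : chi t = chi 0.
  apply/eqP; rewrite -subr_eq0 -normc_eq0 eq_le normc_ge0 andbT.
  apply/ler_addgt0Pr => e e0; rewrite add0r.
  (* The same rotation [z] serves at [t] and at [0], so it drops out of the modulus of the
     difference. *)
  have [z z1 Hz] := chi_near 0 (divr_gt0 e0 (ltr0n R 2)).
  rewrite -[leLHS]mul1r -z1 -normcM mulrBr.
  have -> : z * chi t - z * chi 0 = (z * chi t - chi 0) - (z * chi 0 - chi 0).
    by ring.
  by rewrite (le_trans (ler_normcD _ _)) // normc_opp (splitr e) lerD.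
have [theta thE] := cexpi_surj (normc_chi 0).
by exists theta => // t; rewrite -thE -(chiE t) /chi divfK.
Qed.

End Eigenfunction.

Lemma peripheral_unit (v : contT R) (lambda : R[i]) :
  v != 0 -> L v = lambda *: v -> normc lambda = rho ->
  exists theta : R, is_unit (cexpi (- theta) *: v).
Proof.
move=> v0 Lv nl; have [theta vE v_gt0] := peripheral_eigenfunction v0 Lv nl.
by exists theta => t; rewrite contTZE vE mulrA cexpiNM mul1r ltcR.
Qed.

Lemma transfer_ge0 (u : contT R) t : (forall s, 0 <= u s) -> 0 <= L u t.
Proof.
move=> u0; rewrite /= /transfer_fun mulr_ge0 ?invr_ge0 ?ler0n //.
by apply: sumr_ge0 => i _; rewrite mulr_ge0 //= lecR.
Qed.

(** For the rotated eigenfunction [u], [lambda * u 0] is a value of [L u], hence nonnegative, while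
    [u 0] is positive. Thus [lambda] equals its modulus. *)
Lemma peripheral_eigenvalue lambda :
  is_eigenvalue L lambda -> normc lambda = rho -> lambda = rho%:C.
Proof.
move=> [v v0 Lv] nl; have [theta uu] := peripheral_unit v0 Lv nl.
set u := _ *: v in uu.
have Lu : L u = lambda *: u by rewrite /u linearZ /= Lv !scalerA mulrC.
have : 0 <= lambda.
  rewrite -(pmulr_lge0 _ (uu 0)) -contTZE -Lu.
  by apply: transfer_ge0 => s; exact: ltW.
by move=> l0; rewrite -nl -normc_norm ger0_norm.
Qed.

(** * Simplicity of the eigenvalue [rho] *)

Section PositiveEigenfunction.
Variable p : contT R.
Hypotheses (p_unit : is_unit p) (Lp : L p = rho%:C *: p).

(** The difference vanishes at [0]. Were it nonzero, it would be an eigenfunction and, up to a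
    phase, a unit. *)
Lemma peripheral_eigenspace v : L v = rho%:C *: v -> v = (v 0 / p 0) *: p.
Proof.
move=> Lv; apply: contrapT => /eqP; rewrite -subr_eq0 => vp.
have [||theta /(_ 0)] := @peripheral_unit (v - (v 0 / p 0) *: p) rho%:C vp.
- by rewrite linearB linearZ /= Lv Lp scalerBr !scalerA mulrC.
- by rewrite normc_real gtr0_norm.
rewrite contTZE contTDE contTNE contTZE divfK ?subrr ?mulr0 ?ltxx //.
by rewrite gt_eqF.
Qed.

(** Comparing [1] with the positive eigenfunction sharpens the growth bound from every [s > rho] to
    [rho] itself. *)
Lemma iter_transfer_bound : exists2 C : R, 0 < C &
  forall n t, iter n Lr (fun=> 1) t <= C * rho ^+ n.
Proof.
pose q t := complex.Re (p t).
have q0 t : 0 < q t by rewrite /q; have /gt0_complexE[] := p_unit t.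
have [c c0 cq] := cper_gt0 (cper_Re p) q0.
have [M M0 qM] := cper_bounded (cper_Re p).
have qE : Lr q = fun t => rho * q t.
  apply/funext => t; rewrite -Re_transfer_fun.
  have -> : transfer_fun d (fun t => (f t)%:C) p t = L p t by [].
  by rewrite Lp contTZE ReZ.
exists (M / c) => [|n t]; first by rewrite divr_gt0.
have := iter_rtransfer_ge_cst d n f0 cq t.
rewrite (iter_rtransfer_eigen n qE) mulrAC ler_pdivlMr // [c * _]mulrC.
move=> /le_trans; apply; rewrite mulrC ler_wpM2r ?exprn_ge0 ?(ltW rho0) //.
exact: le_trans (ler_norm _) (qM t).
Qed.

(* A Jordan block would make [L^n u] grow like [n rho^n]. *)
Lemma peripheral_generalized_eigenspace u n :
  iter n (fun v : contT R => L v - rho%:C *: v) u = 0 -> u = (u 0 / p 0) *: p.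
Proof.
set N := fun v : contT R => _.
(* Excluding chains of length two suffices, since longer chains collapse by induction. *)
suff step u' : N (N u') = 0 -> N u' = 0.
  have red m u' : iter m.+1 N u' = 0 -> N u' = 0.
    elim: m u' => [//|m IH] u'; rewrite iterSr => /IH; exact: step.
  case: n => [/= ->|n /red]; first by rewrite contT0E mul0r scale0r.
  by move=> /eqP; rewrite subr_eq0 => /eqP; exact: peripheral_eigenspace.
move=> /eqP; rewrite subr_eq0 => /eqP /peripheral_eigenspace.
set c := _ / _ => NuE; apply: contrapT => Nu0.
have pN0 : p 0 != 0 by rewrite gt_eqF.
have c_gt0 : 0 < normc c.
  rewrite lt_def normc_ge0 andbT normc_eq0; apply/eqP => cE; apply: Nu0.
  by rewrite NuE cE scale0r.
have Lu : L u' = rho%:C *: u' + c *: p by rewrite -NuE /N addrC subrK.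
have LuE k : iter k.+1 L u' =
    (rho ^+ k.+1)%:C *: u' + (k.+1%:R * rho ^+ k)%:C *: (c *: p).
  elim: k => [|k IH]; first by rewrite !expr1 expr0 mulr1 scale1r.
  rewrite iterS IH linearD !linearZ /= Lu Lp !scalerDr !scalerA.
  rewrite -addrA -scalerDl; congr (_ *: _ + _ *: _).
    by rewrite -rmorphM -exprSr.
  by rewrite !rmorphM !rmorphXn /= -[k.+2]addn1 natrD !rmorphD /= rmorph_nat exprS; ring.
have [C C0 HC] := iter_transfer_bound.
have [M M0 uM] := cper_bounded (cper_normc u').
have {}uM t : normc (u' t) <= M by rewrite (le_trans (ler_norm _)).
(* Evaluation of [LuE] at [0], divided by [rho ^+ k], bounds a linearly growing term independently
   of [k]; this fails for large [k] because [c] and [p 0] are nonzero. *)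
have bd k : k.+1%:R * (normc c * normc (p 0)) <= rho * (M * C + M).
  rewrite -(ler_pM2r (exprn_gt0 k rho0)).
  have : iter k.+1 L u' 0 = (rho ^+ k.+1)%:C * u' 0 +
      (k.+1%:R * rho ^+ k)%:C * (c * p 0) by rewrite LuE contTDE !contTZE.
  move=> /eqP; rewrite addrC -subr_eq => /eqP E.
  have -> : k.+1%:R * (normc c * normc (p 0)) * rho ^+ k =
      normc ((k.+1%:R * rho ^+ k)%:C * (c * p 0)).
    rewrite !normcM normc_real ger0_norm ?mulr_ge0 ?exprn_ge0 ?(ltW rho0) //.
    by rewrite mulrAC.
  rewrite -E (le_trans (ler_normcD _ _)) // normc_opp [normc (_%:C * _)]normcM normc_real.
  rewrite ger0_norm ?exprn_ge0 ?(ltW rho0) // mulrDr mulrDl lerD //; last first.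
    have -> : rho * M * rho ^+ k = rho ^+ k.+1 * M by rewrite exprS mulrAC.
    by rewrite ler_wpM2l // exprn_ge0 // ltW.
  rewrite (iter_transfer_val d w u' k.+1).
  apply: le_trans (normc_iter_transfer_fun _ _ _ _ f0) _.
  apply: le_trans (iter_rtransfer_le_cst _ _ f0 uM 0) _.
  have -> : rho * (M * C) * rho ^+ k = M * (C * rho ^+ k.+1).
    by rewrite exprS; ring.
  by rewrite ler_wpM2l // ltW.
have K0 : 0 < normc c * normc (p 0) by rewrite mulr_gt0 // lt_def normc_ge0 normc_eq0 pN0.
have Q0 : 0 <= rho * (M * C + M) / (normc c * normc (p 0)).
  by apply: divr_ge0; [apply: mulr_ge0|]; rewrite ?addr_ge0 ?mulr_ge0 ?normc_ge0 //; exact: ltW.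
have := archi_boundP Q0.
set k := Num.Def.archi_bound _; rewrite ltr_pdivrMr // => B.
have := bd k; apply/negP; rewrite -ltNge (lt_trans B) // ltr_pM2r //.
by rewrite ltr_nat.
Qed.

End PositiveEigenfunction.
End Peripheral.

(** * The Lasota--Yorke inequality *)

Section HoelderReal.
Variables (R : realType) (alpha : R).
Hypothesis alpha0 : 0 < alpha.
Implicit Types (u v : R -> R) (a b : R).

Definition hold a u := forall s t, `|u s - u t| <= a * `|s - t| `^ alpha.

Lemma hold_le a b u : a <= b -> hold a u -> hold b u.
Proof.
by move=> ab ua s t; rewrite (le_trans (ua s t)) // ler_wpM2r ?powR_ge0.
Qed.

Lemma hold_cst a c : 0 <= a -> hold a (fun=> c).
Proof. by move=> a0 s t; rewrite subrr normr0 mulr_ge0 ?powR_ge0. Qed.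

Lemma hold_comb a b x y u v : hold a u -> hold b v ->
  hold (`|x| * a + `|y| * b) (fun t => x * u t + y * v t).
Proof.
move=> ua vb s t; rewrite opprD addrACA -!mulrBr mulrDl -!mulrA.
by rewrite (le_trans (ler_normD _ _)) // !normrM lerD // ler_wpM2l.
Qed.

Lemma hold_mul a b M N u v : hold a u -> hold b v ->
  (forall t, `|u t| <= M) -> (forall t, `|v t| <= N) ->
  hold (M * b + N * a) (fun t => u t * v t).
Proof.
move=> ua vb uM vN s t.
have -> : u s * v s - u t * v t = u s * (v s - v t) + v t * (u s - u t) by ring.
rewrite (le_trans (ler_normD _ _)) // !normrM mulrDl -!mulrA.
by rewrite lerD // ler_pM.
Qed.

Lemma hold_inv a c u : hold a u -> 0 < c -> (forall t, c <= u t) ->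
  hold (a / c ^+ 2) (fun t => (u t)^-1).
Proof.
move=> ua c0 cu s t; have u0 x : 0 < u x by exact: lt_le_trans (cu x).
have -> : (u s)^-1 - (u t)^-1 = (u t - u s) * (u s * u t)^-1.
  by field; rewrite !gt_eqF ?u0.
rewrite normrM distrC mulrAC; apply: ler_pM; rewrite ?normr_ge0 //.
rewrite normfV lef_pV2 ?posrE ?exprn_gt0 ?normr_gt0 ?mulf_neq0 ?gt_eqF //.
by rewrite gtr0_norm ?mulr_gt0 // expr2 ler_pM // ltW.
Qed.

(** The radius depends only on [a] and [e], so it serves all functions with Hoelder constant [a] at
    once. Dividing by [a + 1] covers [a = 0]. *)
Lemma hold_small a e : 0 <= a -> 0 < e -> exists2 h : R, 0 < h &
  forall u, hold a u -> forall s t, `|s - t| <= h -> `|u s - u t| <= e.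
Proof.
move=> a0 e0; have ea : 0 < e / (a + 1) by rewrite divr_gt0 // ltr_wpDl.
exists ((e / (a + 1)) `^ alpha^-1) => [|u ua s t st]; first exact: powR_gt0.
rewrite (le_trans (ua s t)) //.
have : `|s - t| `^ alpha <= e / (a + 1).
  rewrite -[leRHS]powRr1 ?(ltW ea) // -[X in _ <= _ `^ X](@mulVf _ alpha) ?gt_eqF // powRrM.
  by apply: ge0_ler_powR; rewrite ?nnegrE ?powR_ge0 ?normr_ge0 ?(ltW alpha0).
move=> /(ler_wpM2l a0) /le_trans; apply.
rewrite mulrCA -[leRHS]mulr1 ler_wpM2l ?(ltW e0) // ler_pdivrMr ?mul1r ?ltr_wpDl //.
by rewrite lerDl.
Qed.

Lemma hold_continuous a u : 0 <= a -> hold a u -> continuous u.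
Proof.
move=> a0 ua t; apply/cvgrPdist_le => e e0.
have [h h0 Hh] := hold_small a0 e0; apply: filterS (nbhsx_ballx t h h0) => s.
by rewrite -ball_normE /= => /ltW; exact: Hh.
Qed.

End HoelderReal.

Section TransferHoelder.
Variables (R : realType) (d : nat) (alpha : R) (g : R -> R) (F B : R).
Hypotheses (d_gt0 : (0 < d)%N) (alpha0 : 0 < alpha).
Hypotheses (g0 : forall t, 0 <= g t) (gF : hold alpha F g).
Local Notation L := (rtransfer d g).
Hypotheses (B0 : 0 <= B) (LB : forall t, L (fun=> 1) t <= B).
Implicit Types (u A : R -> R) (a b M : R).

(** The factor by which each inverse branch [t -> (t + i) / d] contracts [|s - t|^alpha]. *)
Definition branch_contraction : R := d%:R^-1 `^ alpha.
Local Notation kappa := branch_contraction.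

Lemma branch_dist s t (i : nat) :
  `|(s + i%:R) / d%:R - (t + i%:R) / d%:R| `^ alpha =
  kappa * `|s - t| `^ alpha.
Proof.
rewrite /kappa -powRM ?invr_ge0 //; congr (_ `^ _).
rewrite -mulrBl opprD addrACA subrr addr0 normrM mulrC; congr (_ * _).
by rewrite ger0_norm ?invr_ge0.
Qed.

Let F0 : 0 <= F.
Proof.
have := gF 0 1; rewrite sub0r normrN normr1 powR1 mulr1; exact: le_trans.
Qed.

Let kappa0 : 0 <= kappa. Proof. exact: powR_ge0. Qed.

Let dV_sum (c : R) : d%:R^-1 * \sum_(i < d) c = c.
Proof.
by rewrite sumr_const card_ord -[c *+ d]mulr_natl mulKf // pnatr_eq0 -lt0n.
Qed.

(* [A] is kept as a function so that iterating the estimate produces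
   [L^n 1] and not a power of the norm of [L 1]. *)
Lemma rtransfer_hold_step A b M u : 0 <= b ->
  (forall s t, `|u s - u t| <= (A t + b) * `|s - t| `^ alpha) ->
  (forall t, `|u t| <= M) ->
  forall s t, `|L u s - L u t| <=
    (kappa * L A t + kappa * (B * b + F * M)) * `|s - t| `^ alpha.
Proof.
move=> b0 uA uM s t; set r := `|s - t| `^ alpha.
have r0 : 0 <= r by exact: powR_ge0.
pose Y (x : R) (i : 'I_d) := (x + i%:R) / d%:R.
have M0 : 0 <= M by exact: le_trans (uM 0).
have : `|L u s - L u t| <= d%:R^-1 * \sum_(i < d)
    (g (Y t i) * (A (Y t i) + b * 1) * (kappa * r) + F * M * (kappa * r)).
  rewrite /rtransfer -mulrBr normrM ger0_norm ?invr_ge0 //.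
  rewrite ler_wpM2l ?invr_ge0 // -sumrB (le_trans (ler_norm_sum _ _ _)) //.
  apply: ler_sum => i _; rewrite -/(Y s i) -/(Y t i).
  (* The increment of [u] is weighted by [g] on the branch of [t], so the sum reassembles [L A t];
     the increment of [g] meets only the bound [M] on [u]. *)
  have -> : g (Y s i) * u (Y s i) - g (Y t i) * u (Y t i) =
    g (Y t i) * (u (Y s i) - u (Y t i)) + (g (Y s i) - g (Y t i)) * u (Y s i).
    by ring.
  rewrite (le_trans (ler_normD _ _)) // !normrM (ger0_norm (g0 _)) lerD //.
    by rewrite -mulrA ler_wpM2l // mulr1 -(branch_dist s t i).
  rewrite mulrAC ler_pM // -(branch_dist s t i); exact: gF.
move=> /le_trans; apply.
have E := congr1 (@^~ t) (rtransfer_comb d g 1 b A (fun=> 1)).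
have -> : d%:R^-1 * \sum_(i < d)
    (g (Y t i) * (A (Y t i) + b * 1) * (kappa * r) + F * M * (kappa * r)) =
    (1 * L A t + b * L (fun=> 1) t) * (kappa * r) + F * M * (kappa * r).
  rewrite /= in E; rewrite -E big_split mulrDr dV_sum -mulr_suml [d%:R^-1 * _]mulrA.
  congr (_ * _ * _ + _); apply: eq_bigr => i _; by rewrite mul1r.
have -> : (kappa * L A t + kappa * (B * b + F * M)) * r =
  (1 * L A t + b * B) * (kappa * r) + F * M * (kappa * r) by ring.
by rewrite lerD2r ler_wpM2r ?mulr_ge0 // lerD2l ler_wpM2l.
Qed.

Lemma iter_rtransfer_norm_le n M u : (forall t, `|u t| <= M) ->
  forall t, `|iter n L u t| <= B ^+ n * M.
Proof.
move=> uM; elim: n => [|n IH] t; first by rewrite expr0 mul1r.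
have M0 : 0 <= B ^+ n * M.
  by rewrite mulr_ge0 ?exprn_ge0 // (le_trans _ (uM 0)).
have -> : B ^+ n.+1 * M = B ^+ n * M * B by rewrite exprS; ring.
have H' s : iter n L u s <= B ^+ n * M by rewrite (le_trans (ler_norm _)).
rewrite ler_norml; apply/andP; split; last first.
  apply: le_trans (iter_rtransfer_le_cst d 1 g0 H' t) _.
  by rewrite ler_wpM2l // LB.
have H s : - (B ^+ n * M) <= iter n L u s.
  by have := IH s; rewrite ler_norml => /andP[].
apply: le_trans (iter_rtransfer_ge_cst d 1 g0 H t).
by rewrite mulNr lerN2 ler_wpM2l // LB.
Qed.

(** Each application of [L] contracts the Hoelder part by [kappa] and moves the variation of the
    weight into the sup-norm term. The constant [C] depends on [n] but not on [a], [M] or [u]. *)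
Lemma lasota_yorke n : exists2 C : R, 0 <= C & forall a M u,
  hold alpha a u -> (forall t, `|u t| <= M) ->
  forall s t, `|iter n L u s - iter n L u t| <=
    (kappa ^+ n * a * iter n L (fun=> 1) t + C * M) * `|s - t| `^ alpha.
Proof.
elim: n => [|n [C C0 IH]].
  exists 0 => // a M u ua _ s t.
  by rewrite expr0 mul1r mulr1 mul0r addr0; exact: ua.
exists (kappa * (B * C + F * B ^+ n)) => [|a M u ua uM s t].
  by rewrite mulr_ge0 // addr_ge0 // mulr_ge0 // exprn_ge0.
have M0 : 0 <= M by exact: le_trans (uM 0).
have := rtransfer_hold_step (mulr_ge0 C0 M0) (IH _ _ _ ua uM)
  (iter_rtransfer_norm_le n uM) s t.
move=> /le_trans; apply; rewrite rtransferZ ler_wpM2r ?powR_ge0 //.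
by rewrite exprS le_eqVlt; apply/orP; left; apply/eqP; rewrite -iterS; ring.
Qed.

Lemma rtransfer_hold a M u : hold alpha a u -> (forall t, `|u t| <= M) ->
  hold alpha (kappa * (B * a + F * M)) (L u).
Proof.
move=> ua uM s t.
have a0 : 0 <= a.
  have := ua 0 1; rewrite sub0r normrN normr1 powR1 mulr1; exact: le_trans.
have uA x y : `|u x - u y| <= (0 * 1 + a) * `|x - y| `^ alpha.
  by rewrite mul0r add0r; exact: ua.
have := rtransfer_hold_step a0 uA uM s t.
by rewrite rtransferZ mul0r mulr0 add0r.
Qed.

End TransferHoelder.

(** * The Hoelder eigenfunction *)

Lemma ultra_fmap (T V : Type) (g : T -> V) (U : set_system T) :
  UltraFilter U -> UltraFilter (g @ U).
Proof.
move=> UU; split; first exact: fmap_proper_filter.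
move=> G PG gG; rewrite predeqE => A; split; last exact: gG.
move=> GA; have [//|UnA] := @in_ultra_setVsetC _ _ (g @^-1` A) UU.
have GnA : G (~` A) by exact: gG.
by have [x []] := filter_ex (filterI GA GnA).
Qed.

(** Pointwise convergence suffices because only [d] values of the function enter. *)
Lemma rtransfer_cvg (R : realType) (d : nat) (g : R -> R) (T : Type)
    (G : set_system T) (un : T -> R -> R) (u : R -> R) t : Filter G ->
  (forall s, un n s @[n --> G] --> u s) ->
  rtransfer d g (un n) t @[n --> G] --> rtransfer d g u t.
Proof.
move=> FG Hu; apply: cvgM; first exact: cvg_cst.
apply: cvg_big => [|i _]; first exact: add_continuous.
by apply: cvgM; [exact: cvg_cst|exact: Hu].
Qed.

Section EigenfunctionExistence.
Variables (R : realType) (d : nat) (alpha : R) (f : R -> R) (F : R).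
Hypotheses (d_ge2 : (1 < d)%N) (alpha0 : 0 < alpha).
Hypotheses (cf : cper f) (f0 : forall t, 0 <= f t) (fF : hold alpha F f).
Local Notation L := (rtransfer d f).
Implicit Types u v : R -> R.

Hypothesis krL : forall u, cper u -> (forall t, 0 <= u t) ->
  (exists t, 0 < u t) -> exists n, forall t, 0 < iter n L u t.

Variable rho : R.
Hypotheses (rho0 : 0 < rho)
  (rhoL : forall n b, (forall t, iter n L (fun=> 1) t <= b) -> rho ^+ n <= b)
  (Lrho : forall s, rho < s ->
     exists2 C : R, 0 < C & forall n t, iter n L (fun=> 1) t <= C * s ^+ n).

Local Notation kappa := (branch_contraction d alpha).

Let d_gt0 : (0 < d)%N. Proof. exact: ltnW. Qed.

Lemma branch_contraction_lt1 : 0 < kappa < 1.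
Proof.
have d0 : 0 < d%:R :> R by rewrite ltr0n.
apply/andP; split; first by rewrite powR_gt0 // invr_gt0.
have <- : (1 : R) `^ alpha = 1 by rewrite powR1.
apply: gt0_ltr_powR => //; rewrite ?nnegrE ?invr_ge0 //.
by rewrite invf_lt1 // ltr1n.
Qed.

Lemma transfer1_bound : exists2 B : R, 0 <= B & forall t, L (fun=> 1) t <= B.
Proof.
have [B B0 HB] := cper_bounded (cper_rtransfer d cf (cper_cst 1)).
by exists B; [exact: ltW|move=> t; exact: le_trans (ler_norm _) (HB t)].
Qed.

Lemma contracting_power : exists2 m, (0 < m)%N &
  forall t, kappa ^+ m * iter m L (fun=> 1) t <= rho ^+ m / 4.
Proof.
have /andP[k0 k1] := branch_contraction_lt1.
(* Any [s] strictly between [rho] and [rho / kappa] bounds the growth of [L^n 1] and still gives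
   [kappa * s < rho]; the midpoint is taken. *)
pose s := (rho + rho / kappa) / 2.
have rk : rho < rho / kappa by rewrite ltr_pdivlMr // gtr_pMr.
have rs : rho < s by rewrite /s; lra.
have ks : kappa * s < rho.
  rewrite /s mulrA mulrDr mulrCA divff ?gt_eqF // mulr1.
  have : kappa * rho < rho by rewrite gtr_pMl.
  lra.
have s0 : 0 < s by exact: lt_trans rs.
have ks0 : 0 < kappa * s by rewrite mulr_gt0.
have [C C0 HC] := Lrho rs.
(* [4 * C] yields the factor [1/4], and the extra [1] rules out [m = 0]. *)
have [m] := @exp_dominates _ (rho / (kappa * s)) (4 * C + 1) 1
  ltac:(by rewrite ltr_pdivlMr ?mul1r) ltr01.
rewrite mul1r expr_div_n ltr_pdivlMr ?exprn_gt0 // => Hm.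
exists m => [|t].
  rewrite lt0n; apply/negP => /eqP mE; move: Hm; rewrite mE !expr0.
  by rewrite mulr1; lra.
apply: le_trans (ler_wpM2l (exprn_ge0 m (ltW k0)) (HC m t)) _.
rewrite ler_pdivlMr //; apply/ltW; apply: le_lt_trans Hm.
rewrite [(kappa * s) ^+ m]exprMn.
have X : 0 <= kappa ^+ m * s ^+ m by rewrite mulr_ge0 // exprn_ge0 ?ltW.
have -> : kappa ^+ m * (C * s ^+ m) * 4 = 4 * C * (kappa ^+ m * s ^+ m) by ring.
by rewrite ler_wpM2r // lerDl.
Qed.

(* The partial sums [sum_(n < N) rho^-n L^n 1] of the resolvent at [rho]. *)
Let G u t : R := 1 + rho^-1 * L u t.
Let h N := iter N G (fun=> 0).

Let ri0 : 0 <= rho^-1. Proof. by rewrite invr_ge0 ltW. Qed.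

Let hS N t : h N.+1 t = 1 + rho^-1 * L (h N) t. Proof. by []. Qed.

Let GE u : G u = fun t => 1 * 1 + rho^-1 * L u t.
Proof. by apply/funext => t; rewrite /G mul1r. Qed.

Let ch N : cper (h N).
Proof.
elim: N => [|N IH]; first exact: cper_cst.
rewrite -[h N.+1]/(G (h N)) GE.
by apply: (cper_comb 1 rho^-1 (cper_cst 1)); exact: cper_rtransfer.
Qed.

Let h_le N t : h N t <= h N.+1 t.
Proof.
elim: N t => [|N IH] t.
  rewrite hS addr_ge0 // mulr_ge0 //.
  exact: (@iter_rtransfer_ge0 _ d f 1).
by rewrite [leLHS]hS hS lerD2l ler_wpM2l //; exact: rtransfer_le.
Qed.

Let h_mono N M t : (N <= M)%N -> h N t <= h M t.
Proof.
move=> /subnK <-; elim: (M - N)%N => [|k IH]; first by rewrite add0n.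
by rewrite addSn (le_trans IH).
Qed.

Let h_ge1 N t : (0 < N)%N -> 1 <= h N t.
Proof.
move=> N0; apply: le_trans (h_mono t N0).
rewrite hS lerDl mulr_ge0 //.
by have := @iter_rtransfer_ge0 _ d f 1 (h 0) f0 (fun=> lexx _) t.
Qed.

Let h_ge0 N t : 0 <= h N t.
Proof. by apply: le_trans (h_mono t (leq0n N)). Qed.

Let h_add N m : h (m + N) = fun t => 1 * h m t + rho^-1 ^+ m * iter m L (h N) t.
Proof.
elim: m => [|m IH].
  by apply/funext => t; rewrite add0n expr0 !mul1r add0r.
apply/funext => t; rewrite addSn hS IH rtransfer_comb hS.
rewrite exprS -[iter m.+1 L (h N) t]/(L (iter m L (h N)) t). ring.
Qed.

(** Crude one-step estimates suffice for finitely many partial sums; they start the induction in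
    [h_hold]. *)
Let h_hold_fin m : exists2 H : R, 0 <= H &
  forall j, (j <= m)%N -> hold alpha H (h j).
Proof.
have [B B0 LB] := transfer1_bound.
elim: m => [|m [H H0 IH]].
  by exists 0 => // j; rewrite leqn0 => /eqP ->; exact: hold_cst.
have [M M0 hM] := cper_bounded (ch m).
have HL := rtransfer_hold d_gt0 f0 fF LB (IH m (leqnn m)) hM.
have HS := hold_comb 1 rho^-1 (hold_cst alpha 1 (lexx 0)) HL.
set H' := (X in hold _ X _) in HS.
exists (Num.max H H') => [|j]; first by rewrite le_max H0.
rewrite leq_eqVlt => /orP[/eqP ->|]; last first.
  by rewrite ltnS => /IH; apply: hold_le; rewrite le_max lexx.
rewrite -[h m.+1]/(G (h m)) GE; apply: hold_le HS.
by rewrite le_max lexx orbT.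
Qed.

(* The Lasota--Yorke inequality controls [h_(N + m)] by [h_N] with a factor
   1/4, and [h_N <= h_(N + m)]. *)
Let h_hold : exists2 D : R, 0 <= D &
  forall N M, (forall t, h N t <= M) -> hold alpha (D * M) (h N).
Proof.
have [m m0 mrho] := contracting_power.
have [B B0 LB] := transfer1_bound.
have [C C0 LY] := lasota_yorke d_gt0 f0 fF B0 LB m.
have [H H0 HH] := h_hold_fin m.
have rm0 : 0 < rho ^+ m by rewrite exprn_gt0.
(* This choice closes the recursion: [H + D / 4 + C / rho ^+ m = 3 * D / 4 <= D]. *)
pose D := 2 * (H + C / rho ^+ m).
have CR0 : 0 <= C / rho ^+ m by rewrite divr_ge0 // ltW.
have D0 : 0 <= D by rewrite mulr_ge0 // addr_ge0.
exists D => // N; elim/ltn_ind: N => N IH M hM.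
have M0 : 0 <= M by exact: le_trans (hM 0).
have [Nm|mN] := leqP N m.
  have [->|N0] := posnP N; first by apply: hold_cst; rewrite mulr_ge0.
  have M1 : 1 <= M by exact: le_trans (h_ge1 0 N0) (hM 0).
  apply: hold_le (HH N Nm); apply: (@le_trans _ _ (D * 1)).
    by rewrite mulr1 /D; lra.
  by rewrite ler_wpM2l.
have M1 : 1 <= M by exact: le_trans (h_ge1 0 (ltn_trans m0 mN)) (hM 0).
have NE : N = (m + (N - m))%N by rewrite subnKC // ltnW.
have hNm t : h (N - m) t <= M by apply: le_trans (hM t); rewrite h_mono ?leq_subr.
have IH' : hold alpha (D * M) (h (N - m)).
  by apply: IH => //; rewrite ltn_subrL m0 (ltn_trans m0 mN).
have nM t : `|h (N - m) t| <= M by rewrite ger0_norm.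
have LYm : hold alpha (rho ^+ m / 4 * (D * M) + C * M) (iter m L (h (N - m))).
  move=> s t; apply: le_trans (LY _ _ _ IH' nM s t) _.
  rewrite ler_wpM2r ?powR_ge0 // lerD2r mulrAC.
  by rewrite ler_wpM2r // mulr_ge0.
rewrite NE h_add; apply: hold_le (hold_comb 1 (rho^-1 ^+ m) (HH m (leqnn m)) LYm).
rewrite normr1 mul1r ger0_norm ?exprn_ge0 // exprVn.
have -> : (rho ^+ m)^-1 * (rho ^+ m / 4 * (D * M) + C * M) =
   D * M / 4 + C / rho ^+ m * M by field; rewrite gt_eqF.
have HM : H <= H * M by rewrite ler_peMr.
have := mulr_ge0 CR0 M0; have := mulr_ge0 H0 M0; rewrite /D.
lra.
Qed.

(** If the partial sums were bounded, their limit [H] would satisfy [L H <= rho * (H - 1)], hence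
    [L H <= tau * H] with [tau < rho]. Since [1 <= H], [L^n 1] would then grow more slowly than
    [rho ^+ n]. *)
Let h_unbounded M : exists N t, M < h N t.
Proof.
apply: contrapT => NE.
have hM N t : h N t <= M by rewrite leNgt; apply/negP => MN; apply: NE; exists N, t.
have M1 : 1 <= M := le_trans (h_ge1 0 (ltnSn 0)) (hM 1%N 0).
pose H t : R := limn (fun N => h N t).
have hcvg t : h N t @[N --> \oo] --> H t.
  apply: nondecreasing_is_cvgn; first by move=> N N'; exact: h_mono.
  by exists M => _ [N _ <-].
have hH N t : h N t <= H t.
  apply: limr_ge; first exact: hcvg.
  by exists N => // N' /= ; exact: h_mono.
have HM t : H t <= M.
  by apply: limr_le; [exact: hcvg|exact: nearW].
have LH t : L H t <= rho * (H t - 1).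
  apply: (@closed_cvg _ _ \oo _ (fun N => L (h N) t) (fun x => x <= rho * (H t - 1))).
  - exact: closed_le.
  - apply: nearW => N; have := hH N.+1 t; rewrite hS -lerBrDl.
    by rewrite -(ler_pM2l rho0) mulVKf ?gt_eqF.
  - exact: rtransfer_cvg.
(* From [H <= M] comes [H - 1 <= (1 - (M + 1)^-1) * H]; using [M + 1] rather than [M] keeps [tau]
   positive when [M = 1]. *)
pose tau := rho * (1 - (M + 1)^-1).
have M1' : 0 < M + 1 by lra.
have tau0 : 0 < tau by rewrite mulr_gt0 // subr_gt0 invf_lt1 //; lra.
have tau1 : tau < rho by rewrite gtr_pMr // gtrBl invr_gt0.
have LHt t : L H t <= tau * H t.
  apply: le_trans (LH t) _; rewrite /tau -mulrA ler_wpM2l ?(ltW rho0) //.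
  rewrite mulrBl mul1r lerD2l lerN2 mulrC ler_pdivrMr // mul1r.
  by rewrite (le_trans (HM t)) // lerDl.
have [n] := @exp_dominates _ (rho / tau) M 1
  ltac:(by rewrite ltr_pdivlMr // mul1r) ltr01.
rewrite mul1r expr_div_n ltr_pdivlMr ?exprn_gt0 //.
apply/negP; rewrite -leNgt mulrC; apply: rhoL => t.
have H1 s : 1 <= H s := le_trans (h_ge1 s (ltnSn 0)) (hH 1%N s).
apply: le_trans (@iter_rtransfer_le _ d f n (fun=> 1) H f0 H1 t) _.
apply: le_trans (iter_rtransfer_leZ n f0 (ltW tau0) LHt t) _.
by rewrite ler_wpM2l // exprn_ge0 // ltW.
Qed.

(** The witness is [h N] divided by its maximum, once that exceeds [k + 1]: the defect [rho] in
    [rho * h N - rho <= L (h N)] shrinks to [rho / (k + 1)]. The point [p.2] with value [1] keeps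
    the limit nonzero. *)
Let approx : exists2 D : R, 0 <= D & forall k : nat, exists p : (R -> R) * R,
  [/\ p.2 \in `[0, 1] /\ p.1 p.2 = 1, forall t, 0 <= p.1 t <= 1,
    periodic p.1 1, hold alpha D p.1 &
    forall t, rho * p.1 t - rho / k.+1%:R <= L p.1 t].
Proof.
have [D D0 HD] := h_hold; exists D => // k.
have [N [s kN]] := h_unbounded k.+1%:R.
have [t0 t001 Ht0] := cper_max (ch N).
set c := h N t0 in Ht0.
have kc : k.+1%:R < c by exact: lt_le_trans kN (Ht0 s).
have c0 : 0 < c by apply: le_lt_trans kc.
exists (fun t => c^-1 * h N t, t0); split => /=.
- by split=> //; rewrite mulVf ?gt_eqF.
- move=> t; rewrite mulr_ge0 ?invr_ge0 ?(ltW c0) //=.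
  by rewrite mulrC ler_pdivrMr // mul1r.
- by move=> t; rewrite (ch N).2.
- move=> x y; rewrite -mulrBr normrM gtr0_norm ?invr_gt0 // ler_pdivrMl //.
  by rewrite mulrA (mulrC c); exact: HD.
- move=> t; rewrite rtransferZ ler_pdivlMl //.
  have H : rho * h N t - rho <= L (h N) t.
    have := h_le N t; rewrite hS -lerBlDl -(ler_pM2l rho0) mulVKf ?gt_eqF //.
    by rewrite mulrBr mulr1.
  apply: le_trans H.
  have : rho <= rho / k.+1%:R * c.
    by rewrite -mulrA ler_peMr ?(ltW rho0) // mulrC ler_pdivlMr // mul1r ltW.
  set q := rho / _; rewrite mulrBr (mulrCA c) mulVKf ?gt_eqF //.
  lra.
Qed.

Lemma eigenfunction_exists : exists (u : R -> R) (c D : R), [/\ 0 < c, 0 <= D, cper u /\ hold alpha D u,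
  forall t, c <= u t & L u = fun t => rho * u t].
Proof.
have [D D0 /choice[p Hp]] := approx.
(* Along an ultrafilter every sequence in [[0, 1]] converges, so all pointwise limits exist
   simultaneously; the common Hoelder constant makes the limit continuous. *)
have [U [UU Uoo]] := ultraFilterLemma (@eventually_filter).
have PU : ProperFilter U := @ultra_proper _ _ UU.
have cvg01 (x : nat -> R) : (forall k, 0 <= x k <= 1) ->
    exists2 l : R, 0 <= l <= 1 & x k @[k --> U] --> l.
  move=> x01; have := @segment_compact R 0 1; rewrite compact_ultra.
  move=> /(_ (x @ U)) [||l [/= l01 xl]].
  - exact: ultra_fmap.
  - by apply: (@filterS _ U _ setT) => [k _|]; [rewrite /= in_itv /=|exact: filterT].
  - by exists l => //; move: l01; rewrite in_itv.
pose un k := (p k).1.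
pose u t := lim (un k t @[k --> U]).
have unu t : un k t @[k --> U] --> u t.
  have [|l _ ul] := cvg01 (fun k => un k t); last by apply/cvg_ex; exists l.
  by move=> k; have [_ H _ _ _] := Hp k; exact: H.
have u0 t : 0 <= u t.
  apply: limr_ge; first exact: unu.
  by apply: nearW => k; have [_ /(_ t)/andP[]] := Hp k.
have [|ts _ tscvg] := cvg01 (fun k => (p k).2).
  by move=> k; have [[+ _] _ _ _ _] := Hp k; rewrite in_itv.
have hu : hold alpha D u.
  move=> s t.
  apply: (@closed_cvg _ _ U _ (fun k => `|un k s - un k t|)
            (fun x => x <= D * `|s - t| `^ alpha)).
  - exact: closed_le.
  - by apply: nearW => k; have [_ _ _ /(_ s t)] := Hp k.
  - by have := cvg_norm (cvgB (unu s) (unu t)); exact.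
have pu : periodic u 1.
  move=> t; rewrite /u.
  have -> // : (fun k => un k (t + 1)) = fun k => un k t.
  by apply/funext => k; have [_ _ Hk _ _] := Hp k; exact: Hk.
have cu : cper u by split=> //; exact: (hold_continuous alpha0 D0 hu).
have uN : exists t, 0 < u t.
  (* The maximum points converge to [ts], so the common Hoelder bound gives [un k ts >= 1/2] for
     [U]-almost all [k]. *)
  exists ts; apply: (@lt_le_trans _ _ 2^-1); first by rewrite invr_gt0.
  have [e e0 He] := @hold_small _ _ alpha0 D 2^-1 D0 ltac:(by rewrite invr_gt0).
  apply: limr_ge; first exact: unu.
  move/cvgrPdist_le : tscvg => /(_ _ e0); apply: filterS => k.
  have [[_ E] _ _ Hk _] := Hp k.
  rewrite -/(un k) in E Hk.
  move=> /(He _ Hk ts); rewrite E distrC ler_norml => /andP[_]; lra.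
have Lu t : rho * u t <= L u t.
  apply: (@ler_cvg_to _ U _ R (fun k => rho * un k t - rho * k.+1%:R^-1)
           (fun k => L (un k) t)).
  - rewrite -[X in _ --> X]subr0 -[X in _ - X](mulr0 rho).
    apply: cvgB; apply: cvgM; try exact: cvg_cst.
      exact: unu.
    apply: cvg_trans (@cvg_harmonic R); exact: cvg_app.
  - exact: rtransfer_cvg.
  - by apply: nearW => k; have [_ _ _ _ /(_ t)] := Hp k.
have Lue := krein_subeigen cf f0 krL rho0 Lrho cu u0 uN Lu.
have [c c0 cu'] := krein_eigen_ge cf f0 krL rho0 cu u0 uN Lue.
by exists u, c, D.
Qed.

End EigenfunctionExistence.

(** * Contraction of oscillations *)

Section NormalisedTransfer.
Variables (R : realType) (d : nat) (alpha : R) (g : R -> R) (F : R).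
Hypotheses (d_ge2 : (1 < d)%N) (alpha0 : 0 < alpha).
Hypotheses (cg : cper g) (g0 : forall t, 0 <= g t) (gF : hold alpha F g).
Local Notation T := (rtransfer d g).
Local Notation kappa := (branch_contraction d alpha).
Implicit Types (u v : R -> R) (a o : R).

Hypothesis T1 : T (fun=> 1) = fun=> 1.
Hypothesis krT : forall u, cper u -> (forall t, 0 <= u t) ->
  (exists t, 0 < u t) -> exists n, forall t, 0 < iter n T u t.

Let d_gt0 : (0 < d)%N. Proof. exact: ltnW. Qed.

Let F0 : 0 <= F.
Proof.
have := gF 0 1; rewrite sub0r normrN normr1 powR1 mulr1; exact: le_trans.
Qed.

Let iterT1 n : iter n T (fun=> 1) = fun=> 1.
Proof. by elim: n => // n IH; rewrite iterS IH T1. Qed.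

Let iterT_ge n c u : (forall t, c <= u t) -> forall t, c <= iter n T u t.
Proof.
move=> cu t; have := iter_rtransfer_ge_cst d n g0 cu t.
by rewrite iterT1 mulr1.
Qed.

Let iterT_le n c u : (forall t, u t <= c) -> forall t, iter n T u t <= c.
Proof.
move=> cu t; have := iter_rtransfer_le_cst d n g0 cu t.
by rewrite iterT1 mulr1.
Qed.

(** The two constants are tracked together: the Hoelder constant contracts up to a multiple of the
    oscillation, and the oscillation contracts when the Hoelder constant is a controlled multiple of
    it. *)
Definition spread a o u := hold alpha a u /\ forall s t, u s - u t <= o.

Lemma spread_le a a' o o' u : a <= a' -> o <= o' ->
  spread a o u -> spread a' o' u.
Proof.
move=> aa oo [ua uo]; split; first exact: hold_le ua.
by move=> s t; exact: le_trans (uo s t) oo.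
Qed.

Let iterT_osc n o u : cper u -> (forall s t, u s - u t <= o) ->
  forall s t, iter n T u s - iter n T u t <= o.
Proof.
move=> cu uo s t; have [t0 Ht0] := cper_min cu.
have H1 := iterT_ge n Ht0 t.
have /(iterT_le n)/(_ s) H2 : forall x, u x <= u t0 + o.
  by move=> x; rewrite -lerBlDl.
lra.
Qed.

Let spread_step a o u : cper u -> spread a o u ->
  spread (kappa * (a + F * o)) o (T u).
Proof.
move=> cu [ua uo]; split; last exact: (@iterT_osc 1).
(* Since [T 1 = 1], subtracting [u 0] leaves the increments of [T u] unchanged, and it bounds the
   function by its oscillation. *)
pose v t := 1 * u t + (- u 0) * 1.
have vM t : `|v t| <= o.
  by rewrite /v mul1r mulr1 ler_norml lerNl opprB !uo.
have va : hold alpha a v.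
  by move=> s t; rewrite /v !mul1r !mulr1 opprD addrACA subrr addr0.
have T1' t : T (fun=> 1) t <= 1 by rewrite T1.
have := rtransfer_hold d_gt0 g0 gF T1' va vM.
rewrite mul1r /v rtransfer_comb => H s t; have := H s t.
by rewrite !mul1r T1 opprD addrACA subrr addr0.
Qed.

(** The fixed point of [x = kappa * (x + F)], the limiting ratio of Hoelder constant to oscillation
    in [spread_step]. *)
Let C : R := kappa * F / (1 - kappa).

Let kappa_itv : 0 < kappa < 1. Proof. exact: branch_contraction_lt1. Qed.

Let k0 : 0 < kappa. Proof. by case/andP: kappa_itv. Qed.
Let k1 : kappa < 1. Proof. by case/andP: kappa_itv. Qed.

Let C0 : 0 <= C.
Proof.
by rewrite divr_ge0 ?mulr_ge0 ?(ltW k0) // subr_ge0 ltW.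
Qed.

Let spread_iter n a o u : cper u -> spread a o u ->
  spread (kappa ^+ n * a + C * o) o (iter n T u).
Proof.
move=> cu uao; have o0 : 0 <= o by have := uao.2 0 0; rewrite subrr.
elim: n => [|n IH].
  by apply: spread_le uao => //; rewrite expr0 mul1r lerDl mulr_ge0.
have := spread_step (cper_iter d n cg cu) IH; apply: spread_le => //.
have CE : kappa * (C + F) = C by rewrite /C; field; rewrite subr_eq0 gt_eqF.
have -> // : kappa * (kappa ^+ n * a + C * o + F * o) = kappa ^+ n.+1 * a + C * o.
by rewrite -[in RHS]CE exprS; ring.
Qed.

(** Finitely many uses of the Krein property are merged by the largest exponent and the smallest
    constant; [T 1 = 1] preserves lower bounds for larger exponents. *)
Let tents_ge (h : R) (p : nat -> R) N : 0 < h -> exists n (c : R), 0 < c /\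
  forall j m, (j < N)%N -> (n <= m)%N ->
    forall t, c <= iter m T (fun t => tent h (t - p j)) t.
Proof.
move=> h0; elim: N => [|N [n [c [c0 IH]]]]; first by exists 0%N, 1; split.
have [||n' /(_ n' (leqnn _))[c' c'0 Hc']] :=
  krein_iter_ge cg g0 krT (cper_tent (p N) (ltW h0)).
- by move=> t; exact: tent_ge0 (ltW h0).
- exists (p N); rewrite subrr; apply: lt_le_trans (tent_ge 0 0 (ltW h0)).
  by rewrite mulr0z subr0 normr0 subr0.
exists (maxn n n'), (Num.min c c'); split; first by rewrite lt_min c0.
move=> j m; rewrite ltnS leq_eqVlt geq_max => /orP[/eqP ->|jN] /andP[nm n'm] t.
  rewrite ge_min; apply/orP; right.
  by rewrite -(subnK n'm) iterD; exact: iterT_ge.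
by rewrite ge_min IH.
Qed.

(* If [u] nearly attains its maximum at a point, it dominates one of finitely
   many tents; hence the Krein property becomes uniform. *)
Let osc_contract (A : R) : 0 <= A -> exists n (c : R), 0 < c <= 2^-1 /\
  forall o u, cper u -> spread (A * o) o u ->
  forall m, (n <= m)%N -> forall s t,
    iter m T u s - iter m T u t <= (1 - c) * o.
Proof.
move=> A0.
have [h' h'0 Hh'] := hold_small alpha0 A0 (e := 4^-1) ltac:(by rewrite invr_gt0).
(* Points within [h + h] have values within [1/4], and tents of half-width [h] have height at most
   [1/4]. *)
pose h : R := Num.min (h' / 2) 4^-1.
have h0 : 0 < h by rewrite lt_min divr_gt0 ?invr_gt0 ?ltr0n.
have hh' : h + h <= h'.
  have : h <= h' / 2 by rewrite ge_min lexx.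
  lra.
have h4 : h <= 4^-1 by rewrite ge_min lexx orbT.
pose N := (Num.Def.archi_bound h^-1).+1.
have N0 : 0 < N%:R :> R by rewrite ltr0n.
have Nh : N%:R^-1 < h.
  rewrite -[ltRHS]invrK ltf_pV2 ?posrE ?invr_gt0 //.
  apply: (lt_trans (archi_boundP _)); first by rewrite invr_ge0 ltW.
  by rewrite ltr_nat.
have [n [c [c0 Hc]]] := tents_ge (fun j => j%:R / N%:R) N.+1 h0.
exists n, (Num.min c 2^-1).
have cc : Num.min c 2^-1 <= c by rewrite ge_min lexx.
have c2 : Num.min c 2^-1 <= 2^-1 by rewrite ge_min lexx orbT.
split; first by rewrite lt_min c0 invr_gt0 ltr0n.
set c' := Num.min _ _ in cc c2 *.
move=> o u cu [uA uo] m nm s t.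
have o0 : 0 <= o by have := uo 0 0; rewrite subrr.
have [oE|oN] := eqVneq o 0.
  by rewrite oE mulr0; apply: iterT_osc => // x y; rewrite -oE.
have {o0 oN} o0 : 0 < o by rewrite lt_def oN.
pose v x := o^-1 * u x.
have vE : iter m T v = fun x => o^-1 * iter m T u x by exact: iter_rtransferZ.
suff : iter m T v s - iter m T v t <= 1 - c'.
  by rewrite vE -mulrBr mulrC ler_pdivrMr.
have cv : cper v.
  have := cper_comb o^-1 0 cu cu; congr cper; apply/funext => x.
  by rewrite mul0r addr0.
have vo x y : v x - v y <= 1.
  by rewrite -mulrBr mulrC ler_pdivrMr // mul1r.
have vA : hold alpha A v.
  move=> x y; rewrite -mulrBr normrM gtr0_norm ?invr_gt0 // ler_pdivrMl //.
  by rewrite mulrA (mulrC o).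
have [tm Htm] := cper_min cv; have [tM tM01 HtM] := cper_max cv.
(* An oscillation of at most [1/2] already meets the goal, because [c' <= 1/2]. *)
have [small|big] := leP (v tM - v tm) 2^-1.
  have : iter m T v s - iter m T v t <= 2^-1; last by lra.
  by apply: iterT_osc => // x y; have := HtM x; have := Htm y; lra.
pose j := Num.truncn (N%:R * tM).
move: tM01; rewrite in_itv /= => /andP[tM0 tM1].
have /andP[jle jgt] : j%:R <= N%:R * tM < j.+1%:R by rewrite truncn_itv // mulr_ge0.
have jN : (j < N.+1)%N.
  rewrite ltnS -(ler_nat R) (le_trans jle) // -[leRHS]mulr1 ler_wpM2l //.
have jdist : `|j%:R / N%:R - tM| < h.
  apply: le_lt_trans Nh; rewrite distrC ger0_norm; last first.
    by rewrite subr_ge0 ler_pdivrMr // mulrC.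
  rewrite -(ler_pM2l N0) divff ?gt_eqF // mulrBr mulrCA divff ?gt_eqF // mulr1.
  by move: jgt; rewrite -natr1; lra.
(* Where the tent is positive, [x] is within [h'] of [tM] modulo [1], so
   [v x >= v tM - 1/4 > v tm + 1/4], which covers the height of the tent. *)
have vtent x : v tm + tent h (x - j%:R / N%:R) <= v x.
  have [tx|] := ltP 0 (tent h (x - j%:R / N%:R)); last first.
    by have := Htm x; lra.
  have [l Hl] := tent_gt0 tx.
  have xl : `|(x + (- l)%:~R) - tM| <= h'.
    have -> : x + (- l)%:~R - tM = (x - j%:R / N%:R - l%:~R) + (j%:R / N%:R - tM).
      by rewrite rmorphN /=; ring.
    rewrite (le_trans (ler_normD _ _)) // (le_trans _ hh') // lerD //; exact: ltW.
  have := Hh' v vA _ _ xl; rewrite (cper_int _ _ cv.2) ler_norml => /andP[+ _].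
  have := tent_le (x - j%:R / N%:R) (ltW h0).
  lra.
have lo : v tm + c <= iter m T v t.
  pose tau x := tent h (x - j%:R / N%:R).
  have vt x : v tm * 1 + 1 * tau x <= v x by rewrite mulr1 mul1r; exact: vtent.
  have := @iter_rtransfer_le _ d g m (fun x => v tm * 1 + 1 * tau x) v g0 vt t; rewrite iter_rtransfer_comb iterT1.
  by rewrite mulr1 mul1r; have := Hc j m jN nm t; rewrite -/tau; lra.
have up : iter m T v s <= v tm + 1.
  by apply: iterT_le => x; have := vo x tm; lra.
lra.
Qed.

Lemma spread_contract : exists theta K : R, [/\ 0 < theta < 1, 0 < K &
  forall a u, cper u -> hold alpha a u ->
  forall k, spread (K * theta ^+ k * a) (K * theta ^+ k * a) (iter k T u)].
Proof.
(* Since [C <= A / 4], [kappa ^+ n <= 1/4] and [1 - c >= 1/2], the condition [spread (A * o) o]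
   reproduces itself after [n] steps with [o] replaced by [e * o]. *)
pose A := 4 * C + 1.
have A1 : 1 <= A by rewrite /A; have := C0; lra.
have A0 : 0 <= A by lra.
have [n0 [c [/andP[c0 c2] Hn0]]] := osc_contract A0.
have [n1] := @exp_dominates _ kappa^-1 4 1 ltac:(by rewrite invf_gt1) ltr01.
rewrite mul1r exprVn => Hn1.
pose n := (maxn n0 n1).+1.
have kn : kappa ^+ n <= 4^-1.
  apply: (@le_trans _ _ (kappa ^+ n1)).
    apply: ler_wiXn2l; rewrite ?(ltW k0) ?(ltW k1) //.
    by rewrite /n ltnW // ltnS leq_maxr.
  by rewrite -[leLHS]invrK lef_pV2 ?posrE ?invr_gt0 ?exprn_gt0 // ltW.
have n0n : (n0 <= n)%N by rewrite /n ltnW // ltnS leq_maxl.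
pose e : R := 1 - c.
have e0 : 0 < e by rewrite /e; lra.
have e1 : e < 1 by rewrite /e; lra.
have contract o u : cper u -> spread (A * o) o u ->
    spread (A * (e * o)) (e * o) (iter n T u).
  move=> cu uo; split; last exact: Hn0 uo _ n0n.
  have o0 : 0 <= o by have := uo.2 0 0; rewrite subrr.
  have [+ _] := spread_iter n cu uo; apply: hold_le.
  have H1 : kappa ^+ n * (A * o) <= 4^-1 * (A * o) by rewrite ler_wpM2r ?mulr_ge0.
  have H2 : C * o <= 4^-1 * (A * o).
    rewrite mulrA ler_wpM2r //; rewrite /A; lra.
  have H3 : 2^-1 * (A * o) <= e * (A * o).
    by rewrite ler_wpM2r ?mulr_ge0 // /e; lra.
  rewrite mulrCA; lra.
pose theta := e `^ n%:R^-1.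
have thE : theta ^+ n = e by apply: exprn_root; exact: ltW.
have th0 : 0 < theta by rewrite powR_gt0.
have th1 : theta < 1.
  rewrite ltNge; apply/negP => th1; have := exprn_ege1 n th1.
  by rewrite thE; lra.
(* Dividing by [theta ^+ n] pays for the incomplete last block of [j <= n] steps. *)
pose K := (A + C) / theta ^+ n.
have tn0 : 0 < theta ^+ n by rewrite exprn_gt0.
have AC0 : 0 < A + C by have := C0; lra.
exists theta, K; split; [by rewrite th0|by rewrite divr_gt0|].
move=> a u cu ua k.
have a0 : 0 <= a.
  have := ua 0 1; rewrite sub0r normrN normr1 powR1 mulr1; exact: le_trans.
(* Reduced to [[0, 1]], two points are at distance at most [1], so [a] also bounds the
   oscillation. *)
have ua' : spread (A * a) a u.
  split=> [|s t]; first by apply: hold_le ua; rewrite ler_peMl.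
  rewrite -(cper_int (- Num.floor s) s cu.2) -(cper_int (- Num.floor t) t cu.2).
  have := floor_itv01 s; have := floor_itv01 t.
  set s' := s + _; set t' := t + _; rewrite !in_itv /= => t01 s01.
  have st : `|s' - t'| <= 1 by rewrite ler_norml; lra.
  apply: le_trans (ler_norm _) _; apply: le_trans (ua s' t') _.
  rewrite -[leRHS]mulr1 ler_wpM2l //.
  have : `|s' - t'| `^ alpha <= 1 `^ alpha; last by rewrite powR1.
  by apply: ge0_ler_powR; rewrite ?nnegrE ?normr_ge0 ?ler01 ?(ltW alpha0).
have [q [j [kE jn]]] : exists q j, k = (j + q * n)%N /\ (j <= n)%N.
  by exists (k %/ n)%N, (k %% n)%N; rewrite addnC -divn_eq ltnW // ltn_mod.
have uq : spread (A * (e ^+ q * a)) (e ^+ q * a) (iter (q * n) T u).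
  elim: {kE}q => [|q IH]; first by rewrite expr0 mul1r.
  rewrite mulSn iterD exprS -mulrA.
  apply: contract IH; exact: cper_iter.
have cq : cper (iter (q * n) T u) by exact: cper_iter.
have thk : e ^+ q * theta ^+ n <= theta ^+ k.
  rewrite -thE -exprM mulnC -exprD kE.
  apply: ler_wiXn2l; rewrite ?(ltW th0) ?(ltW th1) //.
  by rewrite addnC leq_add2l.
have eqa0 : 0 <= e ^+ q * a by rewrite mulr_ge0 // exprn_ge0 // ltW.
rewrite {3}kE iterD; apply: spread_le (spread_iter j cq uq).
  apply: (@le_trans _ _ ((A + C) * (e ^+ q * a))).
    rewrite [(A + C) * _]mulrDl lerD2r -[leRHS]mul1r ler_wpM2r ?(mulr_ge0 A0 eqa0) //.
    by rewrite exprn_ile1 ?(ltW k0) ?(ltW k1).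
  rewrite /K mulrA ler_wpM2r //.
  by rewrite -!mulrA ler_wpM2l ?(ltW AC0) // mulrC ler_pdivlMr.
apply: (@le_trans _ _ ((A + C) * (e ^+ q * a))).
  by rewrite ler_peMl //; have := C0; lra.
rewrite /K mulrA ler_wpM2r //.
by rewrite -!mulrA ler_wpM2l ?(ltW AC0) // mulrC ler_pdivlMr.
Qed.

End NormalisedTransfer.

(** * Neumann series *)

Section BoundedLinear.
Variables (R : realType) (X : normedModType R[i]).

Lemma linear_bound_continuous (f : {linear X -> X}) (M : R) : 0 <= M ->
  (forall x, `|f x| <= M%:C * `|x|) -> continuous f.
Proof.
move=> M0 fM x; apply: dist_cvg => e e0.
have M1 : 0 < M + 1 by rewrite ltr_wpDl.
have [A [FA HA]] := cvg_dist _ (@cvg_id _ (nbhs x)) (divr_gt0 e0 M1).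
exists [set y | `|f x - y| <= e%:C]; split => //.
have {}FA : \forall y \near x, A y by [].
apply: filterS FA => y /HA xy /=.
rewrite -linearB (le_trans (fM _)) //.
have M0' : 0 <= M%:C by rewrite lecR.
apply: le_trans (ler_wpM2l M0' xy) _.
by rewrite -rmorphM lecR mulrCA ler_piMr ?(ltW e0) // ler_pdivrMr // mul1r lerDl.
Qed.

(** A bounded part of the complex line through [p] lies in the continuous image of a square of real
    coordinates, which is compact. *)
Lemma precompact_line (p : X) (A : set X) (M : R) :
  (forall x, A x -> exists2 z : R[i], normc z <= M & x = z *: p) ->
  precompact A.
Proof.
move=> AM; pose S : set (R * R) := `[- M, M] `*` `[- M, M].
pose phi (q : R * R) : X := (q.1 +i* q.2) *: p.
have cphi : continuous phi.
  move=> q; apply: dist_cvg => e e0; pose W := complex.Re `|p|.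
  have W0 : 0 <= W by have := normr_ge0 p; rewrite lecE => /andP[].
  have pE : `|p| = W%:C by rewrite RRe_real // normr_real.
  have d0 : 0 < e / (2 * (W + 1)) by rewrite divr_gt0 // mulr_gt0 // ltr_wpDl.
  exists [set x | `|phi q - x| <= e%:C]; split => //=.
  apply: filterS (nbhsx_ballx q _ d0) => -[a b] [].
  rewrite -!ball_normE /= => qa qb.
  rewrite /phi -scalerBl normrZ pE normc_norm -rmorphM lecR /=.
  have := normc_le_ReIm ((q.1 +i* q.2) - (a +i* b)); rewrite /= => H.
  have {}H : normc (q.1 +i* q.2 - (a +i* b)) <= e / (W + 1).
    apply: le_trans H _; have -> : e / (W + 1) = e / (2 * (W + 1)) + e / (2 * (W + 1)).
      by field; rewrite gt_eqF // ltr_wpDl.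
    by rewrite lerD // ltW.
  apply: le_trans (ler_wpM2r W0 H) _.
  by rewrite mulrAC ler_pdivrMr ?ltr_wpDl // ler_wpM2l ?(ltW e0) // lerDl.
have cS : compact (phi @` S).
  apply: continuous_compact; first exact: continuous_subspaceT.
  by apply: compact_setX; exact: segment_compact.
exists (phi @` S) => [x /AM[z zM ->]|].
  exists (complex.Re z, complex.Im z); last by case: z {zM}.
  by split; rewrite /= in_itv /= -ler_norml (le_trans _ zM) ?normc_Re ?normc_Im.
by split=> //; apply: compact_closed cS; exact: norm_hausdorff.
Qed.

End BoundedLinear.

Section NeumannSeries.
Variables (R : realType) (X : completeNormedModType R[i]) (S : {linear X -> X}).
Variables (C c : R) (mu : R[i]).
Hypotheses (C0 : 0 <= C) (c0 : 0 < c) (cmu : c < normc mu).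
Hypothesis SC : forall k x, `|iter k S x| <= (C * c ^+ k)%:C * `|x|.

Let nr (x : X) : R := complex.Re `|x|.

Let nrE x : `|x| = (nr x)%:C. Proof. by rewrite RRe_real // normr_real. Qed.

Let nr_ge0 x : 0 <= nr x. Proof. by rewrite -lecR -nrE normr_ge0. Qed.

Let nrD x y : nr (x + y) <= nr x + nr y.
Proof. by rewrite -lecR rmorphD /= -!nrE ler_normD. Qed.

Let nrZ a x : nr (a *: x) = normc a * nr x.
Proof. by apply: complexI; rewrite rmorphM /= -!nrE normrZ. Qed.

Let mu0 : 0 < normc mu. Proof. exact: lt_trans cmu. Qed.

Let muN0 : mu != 0.
Proof.
by rewrite -normr_gt0 normc_norm (_ : 0 = 0%:C) // ltcR.
Qed.

Let q := c / normc mu.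

Let q0 : 0 < q. Proof. exact: divr_gt0. Qed.

Let q1 : q < 1. Proof. by rewrite ltr_pdivrMr // mul1r. Qed.

(** Partial sums of the Neumann series of [(mu - S)^-1]. *)
Let P n x := \sum_(k < n) mu^-1 ^+ k.+1 *: iter k S x.

Let iterS_linear k a x y : iter k S (a *: x + y) = a *: iter k S x + iter k S y.
Proof. by elim: k => // k IH; rewrite iterS IH linearP. Qed.

Let P_linear n a x y : P n (a *: x + y) = a *: P n x + P n y.
Proof.
rewrite /P scaler_sumr -big_split; apply: eq_bigr => k _ /=.
by rewrite iterS_linear scalerDr !scalerA mulrC.
Qed.

Let PS n x : P n (S x) = S (P n x).
Proof.
rewrite /P linear_sum; apply: eq_bigr => k _.
by rewrite linearZ -iterS iterSr.
Qed.

Let P_telescope n x : mu *: P n x - S (P n x) = x - mu^-1 ^+ n *: iter n S x.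
Proof.
elim: n => [|n IH]; first by rewrite /P big_ord0 scaler0 linear0 subr0 expr0 scale1r subrr.
rewrite /P big_ord_recr /= -/(P n x) scalerDr linearD /= opprD addrACA IH.
rewrite [S (_ *: _)]linearZ /= scalerA exprS mulrA divff // mul1r.
by rewrite addrA subrK.
Qed.

Let term_bound k x : nr (mu^-1 ^+ k.+1 *: iter k S x) <= C / normc mu * nr x * q ^+ k.
Proof.
rewrite nrZ; have -> : normc (mu^-1 ^+ k.+1) = (normc mu)^-1 ^+ k.+1.
  by apply: complexI; rewrite rmorphXn /= fmorphV -!normc_norm normrX normfV.
have H : nr (iter k S x) <= C * c ^+ k * nr x.
  by rewrite -lecR rmorphM /= -!nrE.
have m0 : 0 <= (normc mu)^-1 ^+ k.+1 by rewrite exprn_ge0 // invr_ge0 ltW.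
apply: le_trans (ler_wpM2l m0 H) _.
by rewrite /q expr_div_n exprS !exprVn le_eqVlt; apply/orP; left; apply/eqP; ring.
Qed.

Let tail_bound m n x : nr (P (m + n) x - P m x) <= C / normc mu * nr x / (1 - q) * q ^+ m.
Proof.
set K := C / normc mu * nr x.
have K0 : 0 <= K by rewrite !mulr_ge0 // invr_ge0 ltW.
have q1' : 0 < 1 - q by rewrite subr_gt0.
have : nr (P (m + n) x - P m x) <= K / (1 - q) * (q ^+ m - q ^+ (m + n)).
  elim: n => [|n IH].
    by rewrite addn0 !subrr mulr0 -lecR -nrE normr0.
  rewrite addnS {1}/P big_ord_recr /= -/(P (m + n) x) addrAC.
  apply: le_trans (nrD _ _) _; apply: le_trans (lerD IH (term_bound _ _)) _.
  rewrite -/K exprS le_eqVlt; apply/orP; left; apply/eqP; field.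
  by rewrite gt_eqF.
move=> /le_trans; apply; rewrite ler_wpM2l ?divr_ge0 // ?(ltW q1') //.
by rewrite gerBl exprn_ge0 // ltW.
Qed.

Let bound_small (K e : R) : 0 < e -> exists m, K * q ^+ m <= e.
Proof.
move=> e0; have /cvg_geometric : `|q| < 1 by rewrite ger0_norm // ltW.
move=> /(_ K)/cvgrPdist_le/(_ _ e0)[m _ /(_ m (leqnn m))].
by rewrite /geometric /= sub0r normrN => H; exists m; rewrite (le_trans (ler_norm _)).
Qed.

Let P_cvg x : cvg (P n x @[n --> \oo]).
Proof.
apply: cauchy_cvg; apply: dist_cauchy => e e0.
have [m Hm] := bound_small (C / normc mu * nr x / (1 - q)) (divr_gt0 e0 (ltr0n R 2)).
exists [set P n x | n in [set n | (m <= n)%N]]; split.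
  by exists m => // n /= mn; exists n.
move=> _ _ [n /= mn <-] [n' /= mn' <-]; rewrite nrE lecR.
have H k : (m <= k)%N -> nr (P k x - P m x) <= e / 2.
  by move=> mk; rewrite -(subnKC mk) (le_trans (tail_bound _ _ _)).
have -> : P n x - P n' x = (P n x - P m x) + (-1) *: (P n' x - P m x).
  by rewrite scaleN1r opprB addrA subrK.
apply: le_trans (nrD _ _) _; rewrite nrZ (splitr e).
have -> : normc (-1 : R[i]) = 1 by apply: complexI; rewrite -normc_norm normrN1.
by rewrite mul1r lerD // H.
Qed.

Let V x : X := lim (P n x @[n --> \oo]).

Let PV x : P n x @[n --> \oo] --> V x. Proof. exact: P_cvg. Qed.

Let V_unique x y : P n x @[n --> \oo] --> y -> V x = y.
Proof. by move=> Py; exact: (cvg_lim (@norm_hausdorff _ X) Py). Qed.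

Let V_linear : linear V.
Proof.
move=> a x y; apply: V_unique.
have -> : (fun n => P n (a *: x + y)) = fun n => a *: P n x + P n y.
  by apply/funext => n; rewrite P_linear.
by apply: cvgD; [apply: cvgZr; exact: PV|exact: PV].
Qed.

Let V_bound x : `|V x| <= (C / normc mu / (1 - q))%:C * `|x|.
Proof.
rewrite !nrE -rmorphM lecR; apply/ler_addgt0Pr => e e0.
have [A [FA HA]] := cvg_dist _ (@PV x) e0.
have {}FA : \forall n \near \oo, A (P n x) by [].
have [n /HA] := filter_ex FA; rewrite nrE lecR => Vn.
rewrite -[V x](subrK (P n x)) (le_trans (nrD _ _)) // addrC lerD //.
have := tail_bound 0 n x; rewrite {2}/P big_ord0 subr0 expr0 mulr1 add0n.
by move=> /le_trans; apply; rewrite -!mulrA (mulrC (nr x)).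
Qed.

Let S_continuous : continuous S.
Proof.
apply: (@linear_bound_continuous _ _ _ (C * c)).
  by rewrite mulr_ge0 // ltW.
by move=> x; have := SC 1 x; rewrite expr1.
Qed.

Let remainder_cvg x : x - mu^-1 ^+ n *: iter n S x @[n --> \oo] --> x.
Proof.
apply: dist_cvg => e e0; have [m Hm] := bound_small (C * nr x) e0.
exists [set y | `|x - y| <= e%:C]; split => //.
exists m => // n /= mn; rewrite subKr nrE lecR nrZ.
have -> : normc (mu^-1 ^+ n) = (normc mu)^-1 ^+ n.
  by apply: complexI; rewrite rmorphXn /= fmorphV -!normc_norm normrX normfV.
have H : nr (iter n S x) <= C * c ^+ n * nr x.
  by rewrite -lecR rmorphM /= -!nrE.
have m0 : 0 <= (normc mu)^-1 ^+ n by rewrite exprn_ge0 // invr_ge0 ltW.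
apply: le_trans (ler_wpM2l m0 H) _; apply: le_trans Hm.
have -> : (normc mu)^-1 ^+ n * (C * c ^+ n * nr x) = C * nr x * q ^+ n.
  by rewrite /q expr_div_n exprVn; ring.
rewrite ler_wpM2l ?mulr_ge0 //; apply: ler_wiXn2l => //; exact: ltW.
Qed.

Let V_right x : mu *: V x - S (V x) = x.
Proof.
have H : mu *: P n x - S (P n x) @[n --> \oo] --> mu *: V x - S (V x).
  apply: cvgB; first by apply: cvgZr; exact: PV.
  by apply: (continuous_cvg _ (@S_continuous (V x)) (@PV x)).
rewrite -(cvg_lim (@norm_hausdorff _ X) H); apply: (cvg_lim (@norm_hausdorff _ X)).
under eq_fun do rewrite P_telescope.
exact: remainder_cvg.
Qed.

Let VS x : V (S x) = S (V x).
Proof.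
apply: V_unique.
have -> : (fun n => P n (S x)) = fun n => S (P n x).
  by apply/funext => n; rewrite PS.
exact: (continuous_cvg _ (@S_continuous (V x)) (@PV x)).
Qed.

(** The series is dominated by a geometric one of ratio [c / normc mu]. Telescoping makes its limit
    [V] a right inverse of [mu - S], and [V] commutes with [S], so it is also a left inverse. *)
Lemma neumann_inverse : ~ spectrum S mu.
Proof.
apply; pose VL : {linear X -> X} := HB.pack V (GRing.isLinear.Build _ _ _ _ V V_linear).
exists VL; split; [|move=> x|exact: V_right]; last first.
  by rewrite linearB linearZ /= VS V_right.
apply: (@linear_bound_continuous _ _ VL) V_bound.
by rewrite divr_ge0 ?divr_ge0 ?(ltW mu0) // subr_ge0 ltW.
Qed.

End NeumannSeries.

(** * Conjugation by the eigenfunction and geometric decay *)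

Section Decay.
Variables (R : realType) (d : nat) (alpha : R) (f : R -> R) (F : R).
Hypotheses (d_ge2 : (1 < d)%N) (alpha0 : 0 < alpha).
Hypotheses (cf : cper f) (f0 : forall t, 0 <= f t) (fF : hold alpha F f).
Local Notation L := (rtransfer d f).
Implicit Types v : R -> R.

Hypothesis krL : forall v, cper v -> (forall t, 0 <= v t) ->
  (exists t, 0 < v t) -> exists n, forall t, 0 < iter n L v t.

Variables (rho c D : R) (u : R -> R).
Hypotheses (rho0 : 0 < rho) (c0 : 0 < c) (cu : cper u) (uD : hold alpha D u)
  (uc : forall t, c <= u t) (Lu : L u = fun t => rho * u t).

Let d0 : d%:R != 0 :> R. Proof. by rewrite pnatr_eq0 -lt0n ltnW. Qed.

Let u0 t : 0 < u t. Proof. exact: lt_le_trans (uc t). Qed.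

Lemma cper_mul v v' : cper v -> cper v' -> cper (fun t => v t * v' t).
Proof.
move=> [cv pv] [cv' pv']; split=> [t|t]; last by rewrite pv pv'.
by apply: cvgM; [exact: cv|exact: cv'].
Qed.

Let uV_cper : cper (fun t => (u t)^-1).
Proof.
split=> [t|t]; last by rewrite cu.2.
by apply: cvgV; [rewrite gt_eqF|exact: cu.1].
Qed.

(* With this weight, [T v = L (u v) / (rho u)]: multiplication by [u]
   conjugates [L / rho] to an operator fixing the constants. *)
Definition normalised_weight t := f t * u t * (rho^-1 * (u (d%:R * t))^-1).
Local Notation g := normalised_weight.
Local Notation T := (rtransfer d g).

(** Lets the weight, a function of the preimage, carry the factor [1 / u] taken at the image point:
    that factor is the same on all branches over [t]. *)
Let u_branch t (i : nat) : u (d%:R * ((t + i%:R) / d%:R)) = u t.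
Proof.
rewrite mulrCA divff // mulr1; have := cper_int i t cu.2.
by rewrite -pmulrn.
Qed.

Let TE v : T v = fun t => rho^-1 * (u t)^-1 * L (fun s => u s * v s) t.
Proof.
apply/funext => t; rewrite /rtransfer mulrCA; congr (_ * _).
rewrite mulr_sumr; apply: eq_bigr => i _.
by rewrite /normalised_weight u_branch; ring.
Qed.

Let iterTE n v : iter n T v =
  fun t => rho^-1 ^+ n * (u t)^-1 * iter n L (fun s => u s * v s) t.
Proof.
elim: n => [|n IH].
  by apply/funext => t; rewrite expr0 mul1r mulKf // gt_eqF.
rewrite iterS IH TE; apply/funext => t.
have -> : (fun s => u s * (rho^-1 ^+ n * (u s)^-1 * iter n L (fun x => u x * v x) s))
    = fun s => rho^-1 ^+ n * iter n L (fun x => u x * v x) s.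
  apply/funext => s; rewrite mulrA (mulrCA (u s)) mulfV ?mulr1 //.
  by rewrite gt_eqF.
rewrite rtransferZ exprS -[iter n.+1 L _ t]/(L (iter n L (fun x => u x * v x)) t).
by ring.
Qed.

Let T1 : T (fun=> 1) = fun=> 1.
Proof.
rewrite TE; apply/funext => t.
have -> : (fun s => u s * 1) = u by apply/funext => s; rewrite mulr1.
by rewrite Lu -invfM mulVf // mulf_neq0 // gt_eqF.
Qed.

Let g0 t : 0 <= g t.
Proof.
by rewrite !mulr_ge0 ?invr_ge0 //; exact: ltW.
Qed.

Let udV_cper : cper (fun t => (u (d%:R * t))^-1).
Proof.
split=> t; last first.
  by rewrite mulrDr mulr1 -(cper_int d (d%:R * t) cu.2) -pmulrn.
apply: cvgV; first by rewrite gt_eqF.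
apply: (@cvg_comp _ _ _ (fun s => d%:R * s) u _ (nbhs (d%:R * t))).
  by apply: cvgM; [exact: cvg_cst|exact: cvg_id].
exact: cu.1.
Qed.

Let cg : cper g.
Proof.
apply: cper_mul; first exact: cper_mul.
have := cper_comb rho^-1 0 udV_cper udV_cper; congr cper.
by apply/funext => t; rewrite mul0r addr0.
Qed.

Let g_hold : exists G, hold alpha G g.
Proof.
have [M M0 fM] := cper_bounded cf; have [N N0 uN] := cper_bounded cu.
have [K K0 uK] := cper_bounded udV_cper.
have fuM t : `|f t * u t| <= M * N by rewrite normrM ler_pM.
have H1 := hold_mul fF uD fM uN.
have ud : hold alpha (D * d%:R `^ alpha) (fun t => u (d%:R * t)).
  move=> s t; rewrite -mulrA -powRM // -[X in (X * _) `^ _](ger0_norm (ler0n R d)).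
  by rewrite -normrM mulrBr.
have udc t : c <= u (d%:R * t) by [].
have H2 := hold_comb rho^-1 0 (hold_inv ud c0 udc) (hold_inv ud c0 udc).
have K' t : `|rho^-1 * (u (d%:R * t))^-1 + 0 * (u (d%:R * t))^-1| <= rho^-1 * K.
  by rewrite mul0r addr0 normrM ger0_norm ?invr_ge0 ?(ltW rho0) // ler_wpM2l ?invr_ge0 ?(ltW rho0).
have := hold_mul H1 H2 fuM K'; set G := (X in hold _ X _) => H3.
exists G => s t; have := H3 s t.
by rewrite !mul0r !addr0.
Qed.

Let krT v : cper v -> (forall t, 0 <= v t) ->
  (exists t, 0 < v t) -> exists n, forall t, 0 < iter n T v t.
Proof.
move=> cv v0 [t0 vt0].
have [||n Hn] := krL (cper_mul cu cv).
- by move=> t; rewrite mulr_ge0 // ltW.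
- by exists t0; rewrite mulr_gt0.
exists n => t; rewrite iterTE mulr_gt0 // mulr_gt0 ?invr_gt0 //.
by rewrite exprn_gt0 // invr_gt0.
Qed.

(** For [z = v / u] the iterates [T^k z] approach constants. Subtracting the value at [0] and
    multiplying by [rho ^+ k * u] turns this into decay of [L^k v] modulo the line of [u]. *)
Lemma transfer_decay : exists theta K : R, [/\ 0 < theta < 1, 0 < K &
  forall a M v, cper v -> hold alpha a v -> (forall t, `|v t| <= M) ->
  forall k (y := fun t => iter k L v t - iter k L v 0 / u 0 * u t),
    hold alpha (K * (rho * theta) ^+ k * (a + M)) y /\
    forall t, `|y t| <= K * (rho * theta) ^+ k * (a + M)].
Proof.
have [G gG] := g_hold.
have [theta [K [th01 K0 HK]]] := spread_contract d_ge2 alpha0 cg g0 gG T1 krT.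
have [N N0 uN] := cper_bounded cu.
have D0 : 0 <= D.
  have := uD 0 1; rewrite sub0r normrN normr1 powR1 mulr1; exact: le_trans.
have Dc : 0 <= D / c ^+ 2 by rewrite divr_ge0 // exprn_ge0 // ltW.
have cV t : `|(u t)^-1| <= c^-1.
  by rewrite gtr0_norm ?invr_gt0 // lef_pV2 ?posrE.
pose K1 := D / c ^+ 2 + c^-1.
have K10 : 0 < K1 by rewrite ltr_wpDl // invr_gt0.
have ND : 0 < N + D by rewrite ltr_pwDl.
exists theta, ((N + D) * (K * K1)); split=> //; first by rewrite !mulr_gt0.
move=> a M v cv va vM k.
have M0 : 0 <= M by exact: le_trans (vM 0).
have a0 : 0 <= a.
  have := va 0 1; rewrite sub0r normrN normr1 powR1 mulr1; exact: le_trans.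
pose z t := v t * (u t)^-1.
have cz : cper z by exact: cper_mul.
have za : hold alpha (K1 * (a + M)) z.
  apply: hold_le (hold_mul va (hold_inv uD c0 uc) vM cV).
  have H1 := mulr_ge0 Dc a0; have ci : 0 <= c^-1 by rewrite invr_ge0 ltW.
  have H2 := mulr_ge0 ci M0; rewrite /K1.
  by rewrite mulrDl !mulrDr; move: H1 H2; rewrite [M * _]mulrC; lra.
have [zh zo] := HK _ _ cz za k.
set b := K * theta ^+ k * (K1 * (a + M)) in zh zo.
have uz : (fun s => u s * z s) = v.
  by apply/funext => s; rewrite /z mulrC divfK // gt_eqF.
pose x t := 1 * iter k T z t + (- iter k T z 0) * 1.
have xb t : `|x t| <= b by rewrite /x mul1r mulr1 ler_norml lerNl opprB !zo.
have xh : hold alpha b x.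
  by move=> s t; rewrite /x !mul1r !mulr1 opprD addrACA subrr addr0; exact: zh.
have b0 : 0 <= b by exact: le_trans (xb 0).
have rk : 0 < rho ^+ k by rewrite exprn_gt0.
have yE t : iter k L v t - iter k L v 0 / u 0 * u t = rho ^+ k * (u t * x t).
  rewrite /x iterTE uz mul1r mulr1 exprVn.
  by field; rewrite !gt_eqF.
have Kb : (N + D) * (K * K1) * (rho * theta) ^+ k * (a + M) = rho ^+ k * ((N + D) * b).
  by rewrite exprMn /b; ring.
have xuh := hold_mul uD xh uN xb.
split=> [s t|t]; rewrite Kb !yE.
  rewrite -mulrBr normrM gtr0_norm // -mulrA ler_wpM2l ?(ltW rk) //.
  by apply: le_trans (xuh s t) _; rewrite (mulrC b) -[N * b + D * b]mulrDl -mulrA.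
rewrite normrM gtr0_norm // ler_wpM2l ?(ltW rk) //.
rewrite normrM mulrDl; apply: ler_wpDr; first exact: mulr_ge0.
by rewrite ler_pM.
Qed.

End Decay.

(** * Quasicompactness *)

Lemma has_dimension_line (R : realType) (V : lmodType R[i]) (e : V)
    (E : set V) : e != 0 ->
  (forall u, E u <-> exists c : R[i], u = c *: e) -> has_dimension E 1.
Proof.
move=> e0 HE; exists (fun=> e); split=> [c|].
  rewrite big_ord1 => /eqP; rewrite scaler_eq0 (negPf e0) orbF => /eqP c0 i.
  by rewrite (ord1 i).
apply/seteqP; split=> u; first by move=> /HE[c ->]; exists (fun=> c); rewrite // big_ord1.
by move=> [c _ <-]; apply/HE; exists (c ord0); rewrite big_ord1.
Qed.

Section HoelderSpace.
Variables (R : realType) (alpha : R).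
Hypothesis alpha0 : 0 < alpha.
Implicit Types U : hoelderT alpha.

Lemma hold_neq a (u : R -> R) :
  (forall s t, s != t -> `|u s - u t| <= a * `|s - t| `^ alpha) ->
  hold alpha a u.
Proof.
move=> H s t; have [->|/H//] := eqVneq s t.
by rewrite !subrr normr0 powR0 ?mulr0 // gt_eqF.
Qed.

Lemma hold_Re U : hold alpha (hoelder_seminorm alpha U) (fun t => complex.Re (U t)).
Proof.
apply: hold_neq => s t /(normc_le_hoelder_seminorm U); apply: le_trans.
by apply: le_trans (normc_Re _); case: (U s) => ? ?; case: (U t).
Qed.

Lemma hold_Im U : hold alpha (hoelder_seminorm alpha U) (fun t => complex.Im (U t)).
Proof.
apply: hold_neq => s t /(normc_le_hoelder_seminorm U); apply: le_trans.
by apply: le_trans (normc_Im _); case: (U s) => ? ?; case: (U t).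
Qed.

Lemma real_contT_hoelder a (u : R -> R) (cu : continuous u) (pu : periodic u 1) :
  hold alpha a u -> real_contT cu pu \in hoelder_pred alpha.
Proof.
move=> ua; apply/hoelder_predP; exists a => s t _.
rewrite -[real_contT cu pu s]/((u s)%:C) -[real_contT cu pu t]/((u t)%:C).
by rewrite -rmorphB normc_real.
Qed.

Lemma hoelder_real (u : R -> R) (cu : continuous u) (pu : periodic u 1) :
  real_contT cu pu \in hoelder_pred alpha -> exists F, hold alpha F u.
Proof.
move=> /hoelder_predP[M HM]; exists M; apply: hold_neq => s t /HM.
rewrite -[real_contT cu pu s]/((u s)%:C) -[real_contT cu pu t]/((u t)%:C).
by rewrite -rmorphB normc_real.
Qed.

Lemma hoelder_norm_ge0 U : 0 <= hoelder_norm U.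
Proof. by rewrite addr_ge0 ?hoelder_seminorm_ge0 ?sup_norm_ge0. Qed.

Lemma hoelder_norm_ReIm U b :
  hold alpha b (fun t => complex.Re (U t)) ->
  hold alpha b (fun t => complex.Im (U t)) ->
  (forall t, `|complex.Re (U t)| <= b) -> (forall t, `|complex.Im (U t)| <= b) ->
  hoelder_norm U <= 4 * b.
Proof.
move=> hr hi sr si; have -> : 4 * b = (b + b) + (b + b) by ring.
apply: lerD.
  apply: hoelder_seminorm_le => s t _; rewrite mulrDl.
  apply: le_trans (normc_le_ReIm _) _.
  have := hr s t; have := hi s t.
  by case: (U s) => x y; case: (U t) => x' y' /= A B; rewrite lerD.
apply: sup_norm_le => t; apply: le_trans (normc_le_ReIm _) _.
by rewrite lerD.
Qed.

End HoelderSpace.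

(** * Equality of the lower and upper growth rates *)

Section Rates.
Variables (R : realType) (d : nat) (f : R -> R).
Hypotheses (cf : continuous f) (f0 : forall t, 0 <= f t) (pf : periodic f 1).
Let w : contT R := real_contT cf pf.
Local Notation L := (transfer d w).
Local Notation Lr := (rtransfer d f).

Lemma Re_iter_transfer (U : contT R) n t :
  complex.Re (iter n L U t) = iter n Lr (fun t => complex.Re (U t)) t.
Proof. by rewrite iter_transfer_val -Re_iter_transfer_fun. Qed.

Lemma Im_iter_transfer (U : contT R) n t :
  complex.Im (iter n L U t) = iter n Lr (fun t => complex.Im (U t)) t.
Proof. by rewrite iter_transfer_val -Im_iter_transfer_fun. Qed.

Lemma Re_iter_one n :
  [set complex.Re (iter n L (one_contT R) t) | t in [set: R]] =
  range (iter n Lr (fun=> 1)).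
Proof. by congr image; apply/funext => t; rewrite Re_iter_transfer. Qed.

(** Comparison with the eigenfunction places [L^n 1] between [c / M * rho ^+ n] and
    [M / c * rho ^+ n]; the prefactors disappear under roots. *)
Lemma lower_rate_eigen (rho c M : R) (u : R -> R) : 0 < rho -> 0 < c ->
  (forall t, c <= u t <= M) -> Lr u = (fun t => rho * u t) ->
  lower_rate L = rho.
Proof.
move=> rho0 c0 ucM Lu.
have M0 : 0 < M by have /andP[cu uM] := ucM 0; rewrite (lt_le_trans c0) // (le_trans cu).
have cu t : c <= u t by case/andP: (ucM t).
have uM t : u t <= M by case/andP: (ucM t).
pose m n := circle_min (iter n L (one_contT R)).
have lo n t : c / M * rho ^+ n <= iter n Lr (fun=> 1) t.
  have := iter_rtransfer_le_cst d n f0 uM t.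
  rewrite (iter_rtransfer_eigen n Lu) => H.
  rewrite mulrAC ler_pdivrMr // [leRHS]mulrC (le_trans _ H) //.
  by rewrite mulrC ler_wpM2l ?exprn_ge0 // ltW.
have up n t : iter n Lr (fun=> 1) t <= M / c * rho ^+ n.
  have := iter_rtransfer_ge_cst d n f0 cu t.
  rewrite (iter_rtransfer_eigen n Lu) => H.
  rewrite mulrAC ler_pdivlMr // mulrC (le_trans H) //.
  by rewrite mulrC ler_wpM2r ?exprn_ge0 // ltW.
have loM n : c / M * rho ^+ n <= m n.
  rewrite /m /circle_min Re_iter_one; apply: lb_le_inf.
    by eexists; exists 0.
  by move=> _ [t _ <-].
have upM n : m n <= M / c * rho ^+ n.
  rewrite /m /circle_min Re_iter_one; apply: le_trans (up n 0).
  apply: inf_lbound; last by exists 0.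
  by exists (c / M * rho ^+ n) => _ [t _ <-].
have root (b : R) : 0 < b -> (b * rho ^+ n) `^ n%:R^-1 @[n --> \oo] --> rho.
  move=> b0; have H : b `^ n%:R^-1 * rho @[n --> \oo] --> 1 * rho.
    by apply: cvgM; [exact: cvg_root|exact: cvg_cst].
  rewrite mul1r in H; apply: cvg_trans H; apply: near_eq_cvg.
  near=> n; have [k ->] : exists k, n = k.+1.
    have : (0 < n)%N by near: n; exists 1%N.
    by case: (n) => // k _; exists k.
  by rewrite powRM ?exprn_ge0 ?(ltW b0) ?(ltW rho0) // root_exprn // ltW.
have cM : 0 < c / M by rewrite divr_gt0.
have Mc : 0 < M / c by rewrite divr_gt0.
apply: (cvg_lim (@norm_hausdorff _ R)).
apply: (squeeze_cvgr _ (root _ cM) (root _ Mc)).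
apply: nearW => n; have ge0 b : 0 < b -> 0 <= b * rho ^+ n.
  by move=> b0; rewrite mulr_ge0 ?exprn_ge0 // ltW.
have m0 : 0 <= m n := le_trans (ge0 _ cM) (loM n).
by apply/andP; split; apply: ge0_ler_powR; rewrite ?nnegrE ?invr_ge0 ?ler0n //;
  do ?[exact: ge0|exact: m0|exact: loM|exact: upM].
Unshelve. all: by end_near. Qed.

End Rates.

(** * Rank-one perturbation and quasicompactness on the Hoelder space *)

Section QuasiCompact.
Variables (R : realType) (d : nat) (f : R -> R) (alpha F : R).
Hypotheses (d_ge2 : (1 < d)%N) (alpha0 : 0 < alpha).
Hypotheses (cf : continuous f) (f0 : forall t, 0 <= f t) (pf : periodic f 1).
Let w : contT R := real_contT cf pf.
Hypotheses (fF : hold alpha F f) (wh : w \in hoelder_pred alpha).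
Local Notation L := (transfer d w).
Local Notation Lr := (rtransfer d f).
Local Notation H := (hoelderT alpha).
Let La : {linear H -> H} := hoelder_transfer d (HoelderT wh).

Hypothesis krL : forall v, cper v -> (forall t, 0 <= v t) ->
  (exists t, 0 < v t) -> exists n, forall t, 0 < iter n Lr v t.

Variables (rho c D : R) (u : R -> R).
Hypotheses (rho0 : 0 < rho) (c0 : 0 < c) (cu : continuous u)
  (pu : periodic u 1) (uD : hold alpha D u)
  (uc : forall t, c <= u t) (Lu : Lr u = fun t => rho * u t).

Let cf' : cper f. Proof. by []. Qed.
Let cu' : cper u. Proof. by []. Qed.
Let u0 t : 0 < u t. Proof. exact: lt_le_trans (uc t). Qed.

Definition hoelder_eigenfunction : H := HoelderT (real_contT_hoelder cu pu uD).
Local Notation p := hoelder_eigenfunction.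

Let pE t : p t = (u t)%:C. Proof. by []. Qed.

Lemma hoelder_eigenfunction_unit : is_unit p.
Proof. by move=> t; rewrite pE ltcR. Qed.

Let Lp_val : L p = rho%:C *: (p : contT R).
Proof.
apply: contTP => t; rewrite contTZE pE -rmorphM.
have /= <- := congr1 (@^~ t) Lu.
exact: (congr1 (@^~ t) (iter_transfer_fun_real d f 1 u)).
Qed.

Lemma hoelder_eigenfunction_eigen : La p = rho%:C *: p.
Proof. by apply: val_inj; exact: Lp_val. Qed.

Lemma hoelder_eigenfunction_neq0 : p != 0.
Proof.
apply/eqP => pE0; have := hoelder_eigenfunction_unit 0.
by rewrite pE0 ltxx.
Qed.

Let iterLa n (U : H) : hoelderT_val (iter n La U) = iter n L U.
Proof. by elim: n => // n IH; exact: (congr1 L IH). Qed.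

Let addE (U V : H) t : (U + V) t = U t + V t. Proof. by []. Qed.
Let oppE (U : H) t : (- U) t = - U t. Proof. by []. Qed.
Let scaleE (a : R[i]) (U : H) t : (a *: U) t = a * U t. Proof. by []. Qed.

Let K_fun (U : H) : H := (La U 0 / p 0) *: p.

Let K_linear : linear K_fun.
Proof.
move=> a U V; rewrite /K_fun linearP addE scaleE mulrDl scalerDl -mulrA.
by rewrite scalerA.
Qed.

Let K : {linear H -> H} := HB.pack K_fun (GRing.isLinear.Build _ _ _ _ K_fun K_linear).

Let S_fun (U : H) : H := La U - K U.

Let S_linear : linear S_fun.
Proof.
move=> a U V; by rewrite /S_fun !linearP addrACA scalerDr.
Qed.

Let S : {linear H -> H} := HB.pack S_fun (GRing.isLinear.Build _ _ _ _ S_fun S_linear).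

Let SE U : S U = La U - (La U 0 / p 0) *: p. Proof. by []. Qed.

Let p0N : p 0 != 0. Proof. by rewrite gt_eqF // hoelder_eigenfunction_unit. Qed.

Let Sp : S p = 0.
Proof.
by rewrite SE hoelder_eigenfunction_eigen scaleE mulfK // subrr.
Qed.

Let S_sub_p (x : H) a : S (x - a *: p) = S x.
Proof. by rewrite linearB [S (a *: p)]linearZ_LR Sp scaler0 subr0. Qed.

(** [S] differs from [La] by multiples of [p], which the next application of [S] kills, so only the
    last subtraction survives. *)
Let iterS_La k (U : H) : iter k.+1 S U = S (iter k La U).
Proof.
elim: k => [|k IH]; first exact: erefl.
by rewrite iterS IH [S (iter k La U)]SE S_sub_p.
Qed.

Let iterS_ReIm k (U : H) (q : R[i] -> R) :
  (forall x y, q (x - y) = q x - q y) -> (forall (a : R) x, q (a%:C * x) = a * q x) ->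
  (forall n t, q (iter n L U t) = iter n Lr (fun t => q (U t)) t) ->
  (fun t => q (iter k.+1 S U t)) =
  fun t => iter k.+1 Lr (fun t => q (U t)) t -
           iter k.+1 Lr (fun t => q (U t)) 0 / u 0 * u t.
Proof.
move=> qB qZ qL; apply/funext => t.
rewrite iterS_La SE addE oppE scaleE qB -iterS iterLa qL !pE.
rewrite -mulrA -fmorphV -rmorphM mulrC qZ qL; ring.
Qed.

Let S_bound : exists theta K : R, [/\ 0 < theta < 1, 0 <= K &
  forall k (U : H), `|iter k S U| <= (K * (rho * theta) ^+ k)%:C * `|U|].
Proof.
have [theta [C [th01 C0 HC]]] :=
  transfer_decay d_ge2 alpha0 cf' f0 fF krL rho0 c0 cu' uD uc Lu.
(* The factor [4] comes from real and imaginary parts in both summands of the norm; the [1] covers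
   [k = 0], where [iterS_ReIm] says nothing. *)
exists theta, (4 * C + 1); split=> // [|k U]; first by rewrite addr_ge0 // mulr_ge0 // ltW.
rewrite !hoelderT_normE -rmorphM lecR.
have N0 := hoelder_norm_ge0 U.
case: k => [|k].
  by rewrite expr0 mulr1 ler_peMl //; have := C0; lra.
pose b := C * (rho * theta) ^+ k.+1 * hoelder_norm U.
have th0 : 0 < theta by case/andP: th01.
have b4 : 4 * b <= (4 * C + 1) * (rho * theta) ^+ k.+1 * hoelder_norm U.
  have : 0 <= (rho * theta) ^+ k.+1 * hoelder_norm U.
    by rewrite mulr_ge0 // exprn_ge0 // mulr_ge0 ?(ltW rho0) ?(ltW th0).
  by rewrite /b; lra.
apply: le_trans b4.
have sup_le t : normc (U t) <= sup_norm U := normc_le_sup_norm U t.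
have [hr sr] := HC _ _ _ (cper_Re U) (hold_Re alpha0 U)
  (fun t => le_trans (normc_Re _) (sup_le t)) k.+1.
have [hi si] := HC _ _ _ (cper_Im U) (hold_Im alpha0 U)
  (fun t => le_trans (normc_Im _) (sup_le t)) k.+1.
have ER := @iterS_ReIm k U (@complex.Re R) (fun '(a +i* b) '(c +i* d) => erefl)
  (@ReZ R) (Re_iter_transfer d cf pf U).
have EI := @iterS_ReIm k U (@complex.Im R) (fun '(a +i* b) '(c +i* d) => erefl)
  (@ImZ R) (Im_iter_transfer d cf pf U).
apply: hoelder_norm_ReIm.
- by rewrite ER.
- by rewrite EI.
- by move=> t; have /= -> := congr1 (@^~ t) ER; exact: sr.
- by move=> t; have /= -> := congr1 (@^~ t) EI; exact: si.
Qed.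

Let B : R := Lr (fun=> 1) 0.

Let La0_bound (U : H) : normc (La U 0) <= sup_norm U * B.
Proof.
apply: le_trans (normc_transfer_fun d U 0 f0) _.
exact: (iter_rtransfer_le_cst d 1 f0 (fun t => normc_le_sup_norm U t) 0).
Qed.

Let K_coef (U : H) : normc (La U 0 / p 0) <= B / u 0 * hoelder_norm U.
Proof.
rewrite normcM normcV pE normc_real gtr0_norm // mulrAC ler_wpM2r ?invr_ge0 ?(ltW (u0 0)) //.
apply: le_trans (La0_bound U) _; rewrite mulrC ler_wpM2l //.
  exact: (@iter_rtransfer_ge0 _ d f 1).
by rewrite lerDr hoelder_seminorm_ge0.
Qed.

Let B0 : 0 <= B. Proof. by apply: (@iter_rtransfer_ge0 _ d f 1) => // t; exact: ler01. Qed.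

(** [La] is the sum of [S], bounded by the decay estimate at exponent [1], and of the bounded
    rank-one operator [K]. *)
Let La_continuous : continuous La.
Proof.
have [theta [C [/andP[th0 th1] C0 HC]]] := S_bound.
apply: (@linear_bound_continuous _ _ _ (C * (rho * theta) + B / u 0 * hoelder_norm p)).
  apply: addr_ge0; first by rewrite !mulr_ge0 // ltW.
  by rewrite mulr_ge0 ?hoelder_norm_ge0 // divr_ge0 // ltW.
move=> U; rewrite -[La U](subrK (K U)).
apply: le_trans (ler_normD _ _) _; rewrite rmorphD mulrDl lerD //.
  by have := HC 1%N U; rewrite expr1.
rewrite normrZ !hoelderT_normE normc_norm -!rmorphM lecR [leRHS]mulrAC.
apply: ler_wpM2r; first exact: hoelder_norm_ge0.
exact: K_coef.
Qed.

Let K_compact : compact_operator K.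
Proof.
apply: (@precompact_line _ _ p _ (B / u 0)) => _ [U U1 <-].
exists (La U 0 / p 0) => //; apply: le_trans (K_coef U) _.
move: U1; rewrite /= hoelderT_normE (_ : 1 = 1%:C) // lecR => U1.
by rewrite ler_piMr // divr_ge0 // ltW.
Qed.

(** The Neumann series confines the spectrum of [La - K] to the disc of radius [rho * theta],
    whereas the eigenvalue [rho] lies in the spectrum of [La]. *)
Lemma hoelder_transfer_quasicompact : quasicompact La.
Proof.
split; first exact: La_continuous.
exists K; first exact: K_compact.
have [theta [C [/andP[th0 th1] C0 HC]]] := S_bound.
apply: (@le_lt_trans _ _ (rho * theta)%:E).
  apply: ub_ereal_sup => _ [mu Hmu <-]; rewrite lee_fin leNgt; apply/negP => mub.
  exact: (neumann_inverse C0 (mulr_gt0 rho0 th0) mub HC).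
apply: (@lt_le_trans _ _ rho%:E); first by rewrite lte_fin gtr_pMr.
apply: ereal_sup_ubound; exists rho%:C; last by rewrite normc_real gtr0_norm.
move=> [V [_ VL _]]; have := VL p.
rewrite hoelder_eigenfunction_eigen subrr linear0 => /esym/eqP.
by rewrite (negPf hoelder_eigenfunction_neq0).
Qed.

End QuasiCompact.

(** * Assembly of the assertions for [L] and [La] *)

Unset Implicit Arguments.

Theorem theorem2p5 (R : realType) (d : nat) (f : R -> R)
    (d_ge2 : (2 <= d)%N)
    (f_continuous : continuous f)
    (f_ge0 : forall t, 0 <= f t)
    (f_periodic : periodic f 1) :
  let w : contT R := real_contT f_continuous f_periodic in
  let L : {linear contT R -> contT R} := transfer d w in
  let r : R := lower_rate L in
  (* the real type is [R], so the paper's number R is called [rho] *)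
  let rho : R := upper_rate L in
  krein L ->
  [/\ (* (a) *)
      0 < rho,
      (* (b) *)
      forall (v : contT R) (lambda : R[i]),
        v != 0 -> L v = lambda *: v -> normc lambda = rho ->
        exists theta : R, is_unit (cexpi (- theta) *: v),
      (* (c) *)
      forall lambda : R[i],
        is_eigenvalue L lambda -> normc lambda = rho -> lambda = rho%:C,
      (* (d) *)
      is_eigenvalue L rho%:C -> has_algebraic_multiplicity L rho%:C 1 &
      (* (e) *)
      forall alpha : R, 0 < alpha -> alpha <= 1 ->
      forall w_hoelder : w \in hoelder_pred alpha,
        let La : {linear hoelderT alpha -> hoelderT alpha} :=
          hoelder_transfer d (HoelderT w_hoelder) in
        [/\ quasicompact La,
            r = rho,
            is_eigenvalue La rho%:C,
            has_algebraic_multiplicity La rho%:C 1 &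
            exists v : hoelderT alpha, is_unit v /\ La v = rho%:C *: v]].
Proof.
move=> w L r rho krL.
have d_gt0 : (0 < d)%N by exact: ltnW.
have cf : cper f by [].
have krR := krein_real krL.
have [rho1 [rho_cvg rho_gt0 rhoL Lrho]] := transfer_growth_rate cf f_ge0 krR.
have rhoE : rho = rho1.
  apply: (cvg_lim (@norm_hausdorff _ R)).
  rewrite (_ : (fun n => _) = fun n =>
    sup (range (iter n (rtransfer d f) (fun=> 1))) `^ n%:R^-1) //.
  by apply/funext => n; rewrite /circle_max Re_iter_one.
rewrite {}rhoE {rho}; clear rho_cvg; move: rho1 rho_gt0 rhoL Lrho => rho rho_gt0 rhoL Lrho.
have simple (p : contT R) : is_unit p -> L p = rho%:C *: p ->
    forall u n, iter n (fun v => L v - rho%:C *: v) u = 0 ->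
    u = (u 0 / p 0) *: p.
  move=> pu Lp u n.
  exact: (peripheral_generalized_eigenspace d_gt0 f_ge0 krL rho_gt0 Lrho pu Lp).
have peripheral := peripheral_unit d_gt0 f_ge0 krL rho_gt0 Lrho.
split=> //.
- exact: (peripheral_eigenvalue d_gt0 f_ge0 krL rho_gt0 Lrho).
(* The given eigenfunction is rotated to a unit [p], which then spans the generalized eigenspace. *)
- move=> [v v0 Lv].
  have [theta] := peripheral v rho%:C v0 Lv ltac:(by rewrite normc_real gtr0_norm).
  set p := _ *: v => pu.
  have Lp : L p = rho%:C *: p by rewrite /p linearZ_LR Lv !scalerA mulrC.
  clearbody p.
  apply: (has_dimension_line (e := p)) => [|u].
    by apply/eqP => p0; have := pu 0; rewrite p0 ltxx.
  split=> [[n /(simple p pu Lp) ->]|[a ->]]; first by eexists.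
  exists 1%N; rewrite -[LHS]/(L (a *: p) - rho%:C *: (a *: p)).
  by rewrite [L _]linearZ_LR Lp !scalerA mulrC subrr.
move=> alpha alpha0 _ wh La.
have [F fF] := hoelder_real alpha0 wh.
have [u [c [D [c0 D0 [[cu pu] uD] uc Lu]]]] :=
  eigenfunction_exists d_ge2 alpha0 cf f_ge0 fF krR rho_gt0 rhoL Lrho.
pose p := hoelder_eigenfunction cu pu uD.
have p_unit : is_unit p := hoelder_eigenfunction_unit c0 cu pu uD uc.
have Lap : La p = rho%:C *: p by exact: hoelder_eigenfunction_eigen.
have p0 : p != 0 := hoelder_eigenfunction_neq0 c0 cu pu uD uc.
have [M M0 uM] := cper_bounded (conj cu pu).
split.
- exact: (hoelder_transfer_quasicompact d_ge2 alpha0 f_ge0 fF _ krR rho_gt0 c0 cu pu uD uc Lu).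
- apply: (lower_rate_eigen f_continuous f_ge0 f_periodic rho_gt0 c0 _ Lu (M := M)) => t.
  by rewrite uc (le_trans (ler_norm _) (uM t)).
- by exists p.
- apply: (has_dimension_line p0) => U; split=> [[n Hn]|[a ->]]; last first.
    exists 1%N; rewrite -[LHS]/(La (a *: p) - rho%:C *: (a *: p)).
    by rewrite [La _]linearZ_LR Lap !scalerA mulrC subrr.
  exists (U 0 / p 0); apply: val_inj.
  apply: (simple p p_unit (congr1 val Lap) U n).
  (* The inclusion into [contT] commutes with the operators, so generalized eigenvectors of [La] are
     also ones of [L]. *)
  have -> : iter n (fun v : contT R => L v - rho%:C *: v) U =
      val (iter n (fun V => La V - rho%:C *: V) U).
    by elim: n {Hn} => // n IH; rewrite iterS IH.
  by rewrite Hn.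
- by exists p.
Qed.
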